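(* Let $\mathcal{C}$ be either $\mathcal{C}_{HS}$ or $\mathcal{C}_P$. Let $G$ and $H$ be finitely generated groups and let $i\colon H\to G$ be an injective homomorphism. If $\mathrm{rk}(\Lambda(H))<\infty$ (where $\Lambda(H)$ is taken with respect to the same $\mathcal{C}$) and $G$ is flexibly $\mathcal{C}$-stable, then the group double $G*_HG$ is flexibly $\mathcal{C}$-stable.
   Context: $\mathcal{C}_{HS}$ is the class of groups $\mathrm{Aut}(X)$, where $X$ is a finite-dimensional Hilbert space and $\mathrm{Aut}(X)$ is its unitary group, with the metric $d(A_1,A_2)=\|A_1-A_2\|_{HS}$, $\|A\|_{HS}=\mathrm{Tr}(A^*A)^{1/2}$, $\mathrm{Tr}$ the normalized trace on $X$ (write $\|\cdot\|_{HS,X}$ to indicate $X$). $\mathcal{C}_P$ is the class of groups $\mathrm{Aut}(X)$, where $X$ is a finite set and $\mathrm{Aut}(X)$ is its symmetric group, with the normalized Hamming metric $d(\sigma_1,\sigma_2)=\frac{1}{|X|}\#\{x\in X:\sigma_1(x)\neq\sigma_2(x)\}$. $|X|$ denotes the dimension of the Hilbert space, respectively the size of the set. Flexible stability. A group $G$ is flexibly $\mathcal{C}$-stable if for any sequence of maps $\varphi_n\colon G\to\mathrm{Aut}(X_n)\in\mathcal{C}$ with $d(\varphi_n(g)\varphi_n(h),\varphi_n(gh))\to0$ for all $g,h\in G$ there are $Y_n\supseteq X_n$ (finite-dimensional Hilbert spaces, respectively finite sets) with $|Y_n|/|X_n|\to1$ and homomorphisms $\psi_n\colon G\to\mathrm{Aut}(Y_n)$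 such that for all $g\in G$: in the case $\mathcal{C}_{HS}$, $\|\varphi_n(g)-p_n\psi_n(g)p_n\|_{HS,X_n}\to0$, where $p_n$ is the orthogonal projection of $Y_n$ onto $X_n$; in the case $\mathcal{C}_P$, $\frac{1}{|X_n|}\#\{x\in X_n:\varphi_n(g)(x)\ne\psi_n(g)(x)\}\to0$. $\Lambda(H)$ is the free abelian group with basis $\mathrm{Irr}(H)$, where $\mathrm{Irr}(H)$ is the set of isomorphism classes of finite-dimensional irreducible unitary representations of $H$ (case $\mathcal{C}_{HS}$), respectively of transitive actions of $H$ on finite sets (case $\mathcal{C}_P$); $\mathrm{rk}$ denotes its rank. The group double $G*_HG$ is the amalgamated free product of two copies of $G$ over $H$, both inclusions being $i$: the quotient of $G*G$ by the normal closure of $\{i_1(h)i_2(h)^{-1}:h\in H\}$, where $i_1,i_2$ are $i$ followed by the inclusions of the first and the second copy of $G$. *)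

(* Defs.v *)
From HB Require Import structures.
From mathcomp Require Import all_boot all_order perm all_algebra.
From mathcomp Require Import all_classical all_reals all_analysis.
From mathcomp Require Import complex freeg.

Set Implicit Arguments.
Unset Strict Implicit.
Unset Printing Implicit Defensive.

Import Order.TTheory GRing.Theory Num.Theory.
Import numFieldNormedType.Exports.

Local Open Scope classical_set_scope.
Local Open Scope quotient_scope.
Local Open Scope sesquilinear_scope.
Local Open Scope ring_scope.

Definition is_subgroup (G : groupType) (A : set G) : Prop :=
  [/\ A 1%g, (forall x y, A x -> A y -> A (x * y)%g)
    & (forall x, A x -> A (x^-1)%g)].

Definition is_normal_subgroup (G : groupType) (A : set G) : Prop :=
  is_subgroup A /\ (forall x g, A x -> A (x ^ g)%g).

Definition finitely_generated (G : groupType) : Prop :=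
  exists s : seq G, smallest (@is_subgroup G) [set` s] = setT.

Definition normal_closure (G : groupType) (S : set G) : set G :=
  smallest (@is_normal_subgroup G) S.

Section QuotientByNormalClosure.
Context (G : groupType) (S : set G).
Implicit Types x y z : G.

Lemma normal_closureP : is_normal_subgroup (normal_closure S).
Proof.
split; first split.
- by move=> A [[[]]].
- by move=> x y Ax Ay A hA; case: (hA) => [[[_ AM _] _] _]; apply: AM;
    [exact: Ax|exact: Ay].
- by move=> x Ax A hA; case: (hA) => [[[_ _ AV] _] _]; apply: AV; exact: Ax.
- by move=> x g Ax A hA; case: (hA) => [[_ AJ] _]; apply: AJ; exact: Ax.
Qed.

Definition coset_rel : rel G := fun x y => `[< normal_closure S (x^-1 * y)%g >].

Lemma coset_rel_refl : reflexive coset_rel.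
Proof.
by move=> x; apply/asboolP; rewrite mulVg; case: normal_closureP => -[].
Qed.

Lemma coset_rel_sym : symmetric coset_rel.
Proof.
have [[_ _ NV] _] := normal_closureP.
by move=> x y; apply/asboolP/asboolP => /NV; rewrite invgM invgK.
Qed.

Lemma coset_rel_trans : transitive coset_rel.
Proof.
have [[_ NM _] _] := normal_closureP.
move=> y x z /asboolP xy /asboolP yz; apply/asboolP.
by have := NM _ _ xy yz; rewrite -mulgA mulVKg.
Qed.

Canonical coset_equiv :=
  EquivRel coset_rel coset_rel_refl coset_rel_sym coset_rel_trans.

Definition quotient_group := {eq_quot coset_rel}.
HB.instance Definition _ := Choice.on quotient_group.
HB.instance Definition _ := EqQuotient.on quotient_group.

Definition quotient_one : quotient_group := \pi_quotient_group 1%g.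
Definition quotient_mul (a b : quotient_group) : quotient_group :=
  \pi_quotient_group (repr a * repr b)%g.
Definition quotient_inv (a : quotient_group) : quotient_group :=
  \pi_quotient_group (repr a)^-1%g.

Lemma coset_repr x : normal_closure S (x^-1 * repr (\pi_quotient_group x))%g.
Proof.
apply/asboolP; suff: coset_rel x (repr (\pi_quotient_group x)) by [].
by rewrite -[coset_rel _ _]eqmodE reprK.
Qed.

Lemma coset_eq x y :
  normal_closure S (x^-1 * y)%g -> \pi_quotient_group x = \pi_quotient_group y.
Proof. by move=> xy; apply/eqmodP; apply/asboolP. Qed.

Lemma quotient_mulE x y :
  quotient_mul (\pi x) (\pi y) = \pi_quotient_group (x * y)%g.
Proof.
have [[_ NM NV] NJ] := normal_closureP.
apply/esym/coset_eq.
have hx := coset_repr x; have hy := coset_repr y.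
set x' := repr _ in hx *; set y' := repr _ in hy *.
have -> : ((x * y)^-1 * (x' * y') = (x^-1 * x') ^ y * (y^-1 * y'))%g.
  by rewrite /conjg invgM !mulgA mulgK.
by apply: NM => //; exact: NJ.
Qed.

Lemma quotient_invE x : quotient_inv (\pi x) = \pi_quotient_group (x^-1)%g.
Proof.
have [[_ NM NV] NJ] := normal_closureP.
apply/esym/coset_eq; have hx := coset_repr x.
set x' := repr _ in hx *; rewrite invgK.
have -> : (x * x'^-1 = ((x^-1 * x')^-1) ^ (x^-1))%g.
  by rewrite /conjg invgM !invgK !mulgA mulgK.
by apply: NJ; exact: NV.
Qed.

Lemma quotient_mulA : associative quotient_mul.
Proof.
elim/quotW => x; elim/quotW => y; elim/quotW => z.
by rewrite !quotient_mulE mulgA.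
Qed.

Lemma quotient_mul1 : left_id quotient_one quotient_mul.
Proof. by elim/quotW => x; rewrite quotient_mulE mul1g. Qed.

Lemma quotient_mulr1 : right_id quotient_one quotient_mul.
Proof. by elim/quotW => x; rewrite quotient_mulE mulg1. Qed.

Lemma quotient_mulV : left_inverse quotient_one quotient_inv quotient_mul.
Proof. by elim/quotW => x; rewrite quotient_invE quotient_mulE mulVg. Qed.

Lemma quotient_mulrV : right_inverse quotient_one quotient_inv quotient_mul.
Proof. by elim/quotW => x; rewrite quotient_invE quotient_mulE mulgV. Qed.

HB.instance Definition _ := isGroup.Build quotient_group
  quotient_mulA quotient_mul1 quotient_mulr1 quotient_mulV quotient_mulrV.

End QuotientByNormalClosure.

Section FreeProduct.
Context (G K : groupType).
Local Notation word := (seq (G + K)).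

(* The free product consists of the words in the letters of G and K, modulo the
   smallest congruence that multiplies out adjacent letters of the same factor
   and deletes the letters 1. *)
Inductive word_congr : word -> word -> Prop :=
| WordRefl u : word_congr u u
| WordSym u v : word_congr u v -> word_congr v u
| WordTrans u v w : word_congr u v -> word_congr v w -> word_congr u w
| WordCat u u' v v' :
    word_congr u u' -> word_congr v v' -> word_congr (u ++ v) (u' ++ v')
| WordOneL : word_congr [:: inl 1%g] [::]
| WordOneR : word_congr [:: inr 1%g] [::]
| WordMulL g h : word_congr [:: inl g; inl h] [:: inl (g * h)%g]
| WordMulR g h : word_congr [:: inr g; inr h] [:: inr (g * h)%g].

Definition word_rel : rel word := fun u v => `[< word_congr u v >].

Lemma word_rel_refl : reflexive word_rel.
Proof. by move=> u; apply/asboolP; exact: WordRefl. Qed.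

Lemma word_rel_sym : symmetric word_rel.
Proof. by move=> u v; apply/asboolP/asboolP => /WordSym. Qed.

Lemma word_rel_trans : transitive word_rel.
Proof.
by move=> v u w /asboolP uv /asboolP vw; apply/asboolP; exact: WordTrans vw.
Qed.

Canonical word_equiv :=
  EquivRel word_rel word_rel_refl word_rel_sym word_rel_trans.

Definition free_product := {eq_quot word_rel}.
HB.instance Definition _ := Choice.on free_product.
HB.instance Definition _ := EqQuotient.on free_product.

Definition letter_inv (a : G + K) : G + K :=
  match a with inl g => inl (g^-1)%g | inr k => inr (k^-1)%g end.
Definition word_inv (u : word) : word := rev (map letter_inv u).

Definition free_product_one : free_product := \pi_free_product [::].
Definition free_product_mul (a b : free_product) : free_product :=
  \pi_free_product (repr a ++ repr b).
Definition free_product_inv (a : free_product) : free_product :=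
  \pi_free_product (word_inv (repr a)).

Lemma word_repr u : word_congr u (repr (\pi_free_product u)).
Proof.
apply/asboolP; suff: word_rel u (repr (\pi_free_product u)) by [].
by rewrite -[word_rel _ _]eqmodE reprK.
Qed.

Lemma word_eq u v :
  word_congr u v -> \pi_free_product u = \pi_free_product v.
Proof. by move=> uv; apply/eqmodP; apply/asboolP. Qed.

Lemma word_inv_congr u v :
  word_congr u v -> word_congr (word_inv u) (word_inv v).
Proof.
elim=> {u v} [u|u v _|u v w _ uv _ vw|u u' v v' _ hu _ hv| | |g h|g h].
- exact: WordRefl.
- exact: WordSym.
- exact: WordTrans uv vw.
- by rewrite /word_inv !map_cat !rev_cat; exact: WordCat.
- by rewrite /word_inv /= invg1; exact: WordOneL.
- by rewrite /word_inv /= invg1; exact: WordOneR.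
- by rewrite /word_inv /= invgM; exact: WordMulL.
- by rewrite /word_inv /= invgM; exact: WordMulR.
Qed.

Lemma letter_mulV a : word_congr [:: letter_inv a; a] [::].
Proof.
case: a => [g|k] /=.
- by apply: WordTrans (WordMulL _ _) _; rewrite mulVg; exact: WordOneL.
- by apply: WordTrans (WordMulR _ _) _; rewrite mulVg; exact: WordOneR.
Qed.

Lemma word_mulV u : word_congr (word_inv u ++ u) [::].
Proof.
elim: u => [|a u IHu]; first exact: WordRefl.
apply: WordTrans IHu; rewrite /word_inv /= rev_cons -cats1 -catA.
apply: WordCat (WordRefl _) _.
exact: (WordCat (letter_mulV a) (WordRefl u)).
Qed.

Lemma word_invK : involutive word_inv.
Proof.
by move=> u; rewrite /word_inv map_rev revK mapK // => -[g|k] /=; rewrite invgK.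
Qed.

Lemma free_product_mulE u v :
  free_product_mul (\pi u) (\pi v) = \pi_free_product (u ++ v).
Proof. by apply/esym/word_eq/WordCat; exact: word_repr. Qed.

Lemma free_product_invE u :
  free_product_inv (\pi u) = \pi_free_product (word_inv u).
Proof. by apply/esym/word_eq/word_inv_congr; exact: word_repr. Qed.

Lemma free_product_mulA : associative free_product_mul.
Proof.
elim/quotW => u; elim/quotW => v; elim/quotW => w.
by rewrite !free_product_mulE catA.
Qed.

Lemma free_product_mul1 : left_id free_product_one free_product_mul.
Proof. by elim/quotW => u; rewrite free_product_mulE. Qed.

Lemma free_product_mulr1 : right_id free_product_one free_product_mul.
Proof. by elim/quotW => u; rewrite free_product_mulE cats0. Qed.

Lemma free_product_mulV :
  left_inverse free_product_one free_product_inv free_product_mul.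
Proof.
elim/quotW => u; rewrite free_product_invE free_product_mulE.
exact/word_eq/word_mulV.
Qed.

Lemma free_product_mulrV :
  right_inverse free_product_one free_product_inv free_product_mul.
Proof.
elim/quotW => u; rewrite free_product_invE free_product_mulE.
by apply: word_eq; rewrite -{1}[u]word_invK; exact: word_mulV.
Qed.

HB.instance Definition _ := isGroup.Build free_product free_product_mulA
  free_product_mul1 free_product_mulr1 free_product_mulV free_product_mulrV.

Definition free_product_inl (g : G) : free_product :=
  \pi_free_product [:: inl g].
Definition free_product_inr (k : K) : free_product :=
  \pi_free_product [:: inr k].

End FreeProduct.

Definition group_double (H G : groupType) (i : H -> G) : groupType :=
  @quotient_group (free_product G G)
    [set (free_product_inl G (i h) * (free_product_inr G (i h))^-1)%g | h in setT].

Section FlexibleStability.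
Context (R : realType) (G : groupType).
Local Notation C := R[i].

Definition normalized_trace (n : nat) (A : 'M[C]_n) : C := \tr A / n%:R.

Definition hs_norm (n : nat) (A : 'M[C]_n) : R :=
  Num.sqrt (complex.Re (normalized_trace (A^t* *m A))).

Definition is_unitary_rep (n : nat) (rho : G -> 'M[C]_n) : Prop :=
  (forall g, rho g \is unitarymx) /\
  (forall g h, rho (g * h)%g = rho g *m rho h).

(* A finite-dimensional Hilbert space is C^d with d > 0 (for d = 0 there is no
   normalized trace), matrices acting on column vectors.  An inclusion of C^d
   into C^e is an isometry J, with adjoint J^t*; the compression to C^d of an
   operator B of C^e is then J^t* *m B *m J. *)
Definition flexibly_HS_stable : Prop :=
  forall (d : nat -> nat) (phi : forall n, G -> 'M[C]_(d n)),
    (forall n, (0 < d n)%N) ->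
    (forall n g, phi n g \is unitarymx) ->
    (forall g h, hs_norm (phi n g *m phi n h - phi n (g * h)%g)
                   @[n --> \oo] --> (0 : R)) ->
  exists (e : nat -> nat) (J : forall n, 'M[C]_(e n, d n))
         (psi : forall n, G -> 'M[C]_(e n)),
    [/\ forall n, (J n)^t* *m J n = 1%:M,
        ((e n)%:R / (d n)%:R : R) @[n --> \oo] --> (1 : R),
        forall n, is_unitary_rep (psi n)
      & forall g, hs_norm (phi n g - (J n)^t* *m psi n g *m J n)
                    @[n --> \oo] --> (0 : R)].

(* The product of {perm X} is (s * t) x = t (s x), the opposite of the
   composition of maps, so actions are spelled out pointwise. *)
Definition is_action_on (X : finType) (a : G -> {perm X}) : Prop :=
  forall g h x, a (g * h)%g x = a g (a h x).

Definition proportion (X : finType) (P : pred X) : R := #|P|%:R / #|X|%:R.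

Definition flexibly_P_stable : Prop :=
  forall (X : nat -> finType) (phi : forall n, G -> {perm X n}),
    (forall n, (0 < #|X n|)%N) ->
    (forall g h,
       proportion [pred x : X n | phi n g (phi n h x) != phi n (g * h)%g x]
         @[n --> \oo] --> (0 : R)) ->
  exists (Y : nat -> finType) (j : forall n, X n -> Y n)
         (psi : forall n, G -> {perm Y n}),
    [/\ forall n, injective (j n),
        (#|Y n|%:R / #|X n|%:R : R) @[n --> \oo] --> (1 : R),
        forall n, is_action_on (psi n)
      & forall g, proportion [pred x : X n | j n (phi n g x) != psi n g (j n x)]
                    @[n --> \oo] --> (0 : R)].

End FlexibleStability.

Section IrrHS.
Context (R : realType) (H : groupType).
Local Notation C := R[i].

Definition is_irreducible_rep (n : nat) (rho : H -> 'M[C]_n) : Prop :=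
  (0 < n)%N /\
  forall W : {vspace 'cV[C]_n},
    (forall h (v : 'cV[C]_n), v \in W -> rho h *m v \in W) ->
    W = 0%VS \/ W = fullv.

Record irr_unitary_rep := IrrUnitaryRep {
  rep_dim : nat;
  rep_mx : H -> 'M[C]_rep_dim;
  rep_mxP : is_unitary_rep rep_mx;
  rep_irr : is_irreducible_rep rep_mx }.

Definition rep_iso (r s : irr_unitary_rep) : Prop :=
  exists U : 'M[C]_(rep_dim s, rep_dim r),
    [/\ U^t* *m U = 1%:M, U *m U^t* = 1%:M
      & forall h, U *m rep_mx r h = rep_mx s h *m U].

Definition rep_iso_rel : rel {classic irr_unitary_rep} :=
  fun r s => `[< rep_iso r s >].

Lemma rep_iso_refl : reflexive rep_iso_rel.
Proof.
move=> r; apply/asboolP; exists 1%:M.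
by split=> [| |h]; rewrite ?trmx1 ?map_mx1 ?mulmx1 ?mul1mx.
Qed.

Lemma rep_iso_symP r s : rep_iso r s -> rep_iso s r.
Proof.
case=> U [U1 U2 UE]; exists (U^t*); split=> [| |h]; rewrite ?trmxCK //.
by rewrite -[LHS]mulmx1 -U2 !mulmxA -(mulmxA _ _ U) -UE !mulmxA U1 mul1mx.
Qed.

Lemma rep_iso_sym : symmetric rep_iso_rel.
Proof. by move=> r s; apply/asboolP/asboolP => /rep_iso_symP. Qed.

Lemma rep_iso_trans : transitive rep_iso_rel.
Proof.
move=> s r t /asboolP [U [U1 U2 UE]] /asboolP [V [V1 V2 VE]].
apply/asboolP; exists (V *m U); split=> [| |h].
- by rewrite trmx_mul map_mxM !mulmxA -(mulmxA _ _ V) V1 mulmx1.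
- by rewrite trmx_mul map_mxM !mulmxA -(mulmxA _ U) U2 mulmx1.
- by rewrite -mulmxA UE !mulmxA VE.
Qed.

Canonical rep_iso_equiv :=
  EquivRel rep_iso_rel rep_iso_refl rep_iso_sym rep_iso_trans.

Definition Irr_HS : choiceType := {eq_quot rep_iso_rel}.

End IrrHS.

Section IrrP.
Context (H : groupType).

(* Every finite set is in bijection with some 'I_n, so these represent all the
   isomorphism classes of transitive actions on finite sets. *)
Record transitive_action := TransitiveAction {
  act_size : nat;
  act_perm : H -> {perm 'I_act_size};
  act_permP : is_action_on act_perm;
  act_nonempty : (0 < act_size)%N;
  act_trans : forall x y, exists h, act_perm h x = y }.

Definition act_iso (a b : transitive_action) : Prop :=
  exists f : 'I_(act_size a) -> 'I_(act_size b),
    bijective f /\ forall h x, f (act_perm a h x) = act_perm b h (f x).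

Definition act_iso_rel : rel {classic transitive_action} :=
  fun a b => `[< act_iso a b >].

Lemma act_iso_refl : reflexive act_iso_rel.
Proof. by move=> a; apply/asboolP; exists id; split=> //; exists id. Qed.

Lemma act_iso_symP a b : act_iso a b -> act_iso b a.
Proof.
case=> f [[g fK gK] fE]; exists g; split; first by exists f.
by move=> h x; apply: (can_inj fK); rewrite fE !gK.
Qed.

Lemma act_iso_sym : symmetric act_iso_rel.
Proof. by move=> a b; apply/asboolP/asboolP => /act_iso_symP. Qed.

Lemma act_iso_trans : transitive act_iso_rel.
Proof.
move=> b a c /asboolP [f [bf fE]] /asboolP [g [bg gE]].
apply/asboolP; exists (g \o f); split; first exact: bij_comp.
by move=> h x /=; rewrite fE gE.
Qed.

Canonical act_iso_equiv :=
  EquivRel act_iso_rel act_iso_refl act_iso_sym act_iso_trans.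

Definition Irr_P : choiceType := {eq_quot act_iso_rel}.

End IrrP.

Definition Z_independent (A : zmodType) (n : nat) (a : 'I_n -> A) : Prop :=
  forall c : 'I_n -> int, \sum_(k < n) a k *~ c k = 0 -> forall k, c k = 0.

(* The rank of an abelian group is the supremum of the sizes of its
   Z-linearly independent families. *)
Definition finite_rank (A : zmodType) : Prop :=
  exists r : nat, forall (n : nat) (a : 'I_n -> A),
    Z_independent a -> (n <= r)%N.

Inductive metric_class := C_HS | C_P.

Definition flexibly_stable (R : realType) (c : metric_class) (G : groupType)
    : Prop :=
  match c with
  | C_HS => flexibly_HS_stable R G
  | C_P => flexibly_P_stable R G
  end.

Definition Irr (R : realType) (c : metric_class) (H : groupType) : choiceType :=
  match c with
  | C_HS => Irr_HS R H
  | C_P => Irr_P H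
  end.

Definition Lambda (R : realType) (c : metric_class) (H : groupType) : zmodType :=
  {freeg (Irr R c H) / int}.

(* Main.v *)
Require Import Defs.
From HB Require Import structures.
From mathcomp Require Import all_boot all_order perm all_algebra.
From mathcomp Require Import all_classical all_reals all_analysis.
From mathcomp Require Import complex freeg.
From mathcomp Require Import zify ring lra.

Set Implicit Arguments.
Unset Strict Implicit.
Unset Printing Implicit Defensive.

Import Order.TTheory GRing.Theory Num.Theory.
Import numFieldNormedType.Exports.

Local Open Scope classical_set_scope.
Local Open Scope quotient_scope.
Local Open Scope sesquilinear_scope.
Local Open Scope ring_scope.

(** Restricting an almost action of the double on [X] to the two copies of [G]
    gives two almost actions of [G], hence two actions [a1], [a2] on spaces
    [Y1], [Y2] barely larger than [X], which almost agree on [H].  As [H] has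
    finitely many irreducibles, [a1] and [a2] have a common [H]-subobject [K0]
    covering almost all of [X]: in the permutation case because only finitely
    many elements of [H] act differently, in the Hilbert-Schmidt case because a
    uniform spectral gap puts a true intertwiner near the identification of the
    two copies of [X], whose polar part is the required partial isometry.  The
    small complements [K1], [K2] of [K0] need not be isomorphic over [H], but
    the difference of their multiplicity vectors lies in the subgroup of a
    finitely generated free abelian group spanned by the restrictions of
    [G]-objects; in such a subgroup every vector is reached at a cost linear in
    its norm, so adding small [G]-objects [B1], [B2] makes them isomorphic.
    Conjugating [a2 + B2] by the resulting isomorphism gives two actions of [G]
    that agree on [H]. *)

(** * Group doubles *)

(** The defects of an almost action are o(|X|) with no rate, so every repair must cost at most a
    constant times the defect, with a constant that does not depend on [X]; finiteness of the set of
    irreducibles is what provides such constants. The work is therefore done for a single [X] with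
    one budget [N], in [amalgamate_actions] and [amalgamate_reps], and limits enter only at the end,
    through the quotient of [N] by |X|. The multiplicities of [K2] minus those of [K1] are those of
    the restriction of [Y2] minus those of the restriction of [Y1], since [K0] cancels. So
    [G]-objects reach this difference, but huge ones; the linear cost is what replaces them by small
    ones. In the Hilbert-Schmidt case distances are squared and unnormalized, which puts them on the
    scale of dimensions. The spectral gap is linear in these squares, and the polar part is compared
    with the intertwiner through a variational inequality instead of singular values, so the bounds
    stay linear in [N] and no square root is lost. *)

Section GroupDouble.
Context (G H : groupType) (i : {multiplicative H -> G}).
Local Notation S :=
  [set (free_product_inl G (i h) * (free_product_inr G (i h))^-1)%g | h in setT].

Definition double_inl (g : G) : group_double i :=
  \pi_(quotient_group S) (free_product_inl G g).
Definition double_inr (g : G) : group_double i :=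
  \pi_(quotient_group S) (free_product_inr G g).

Lemma double_piM (x y : free_product G G) :
  \pi_(quotient_group S) (x * y)%g =
  ((\pi_(quotient_group S) x : group_double i) * \pi_(quotient_group S) y)%g.
Proof. by rewrite -quotient_mulE. Qed.

Lemma double_inlM g h :
  double_inl (g * h)%g = (double_inl g * double_inl h)%g.
Proof.
rewrite /double_inl -double_piM; congr (\pi_(quotient_group S) _).
apply/esym; rewrite [LHS]free_product_mulE; exact/word_eq/WordMulL.
Qed.

Lemma double_inrM g h :
  double_inr (g * h)%g = (double_inr g * double_inr h)%g.
Proof.
rewrite /double_inr -double_piM; congr (\pi_(quotient_group S) _).
apply/esym; rewrite [LHS]free_product_mulE; exact/word_eq/WordMulR.
Qed.

Lemma double_inl_inr h : double_inl (i h) = double_inr (i h).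
Proof.
set a := free_product_inl G (i h); set b := free_product_inr G (i h).
have [_ NJ] := @normal_closureP (free_product G G) S.
apply/esym; apply: coset_eq.
have -> : (b^-1 * a = (a * b^-1) ^ a)%g by rewrite /conjg -mulgA mulKg.
by apply: NJ; apply: sub_gen_smallest; exists h.
Qed.

(** Inverses of letters are letters, so the two images generate the double as a monoid; an estimate
    then only has to pass to products. *)
Lemma double_ind (P : group_double i -> Prop) :
  (forall g, P (double_inl g)) -> (forall g, P (double_inr g)) ->
  (forall x y, P x -> P y -> P (x * y)%g) -> forall x, P x.
Proof.
move=> Pl Pr PM; elim/quotW => x; move: x; elim/quotW => u.
elim: u => [|a u IHu].
  suff -> : \pi_(free_product G G) [::] = free_product_inl G 1%g by exact: Pl.
  by apply/esym/word_eq; exact: WordOneL.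
have -> : \pi_(free_product G G) (a :: u) =
    (\pi_(free_product G G) [:: a] * \pi_(free_product G G) u)%g.
  by rewrite [RHS]free_product_mulE.
by rewrite double_piM; apply: PM => //; case: a.
Qed.

Section UniversalProperty.
Context (T : Type) (one : T) (mul : T -> T -> T) (f1 f2 : G -> T).
Hypotheses (mulA : associative mul) (mul1 : left_id one mul).
Hypothesis mulr1 : right_id one mul.
Hypotheses (f11 : f1 1%g = one) (f1M : {morph f1 : x y / (x * y)%g >-> mul x y}).
Hypotheses (f21 : f2 1%g = one) (f2M : {morph f2 : x y / (x * y)%g >-> mul x y}).
Hypothesis f12 : forall h, f1 (i h) = f2 (i h).

Let ev (u : seq (G + G)) : T :=
  foldr (fun a t => mul (match a with inl g => f1 g | inr g => f2 g end) t) one u.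

Let ev_cat u v : ev (u ++ v) = mul (ev u) (ev v).
Proof. by elim: u => [|a u IHu] /=; rewrite ?mul1 // IHu mulA. Qed.

Let ev_congr u v : word_congr u v -> ev u = ev v.
Proof.
elim=> {u v} //=.
- by move=> u v w _ -> _ ->.
- by move=> u u' v v' _ uu' _ vv'; rewrite !ev_cat uu' vv'.
- by rewrite f11 mul1.
- by rewrite f21 mul1.
- by move=> g h; rewrite !mulr1 f1M.
- by move=> g h; rewrite !mulr1 f2M.
Qed.

Let evf (x : free_product G G) : T := ev (repr x).

Let evf_pi u : evf (\pi u) = ev u.
Proof. by apply/esym/ev_congr; exact: word_repr. Qed.

Let evfM x y : evf (x * y)%g = mul (evf x) (evf y).
Proof. by rewrite [in LHS]/evf [ev _]evf_pi ev_cat. Qed.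

Let evf1 : evf 1%g = one.
Proof. by rewrite [evf _]evf_pi. Qed.

(** The elements sent to [one] form a normal subgroup containing the relators. As [T] has no
    inverses, closure under them comes from evf(y^-1) = evf(y^-1) evf(y) = evf(1). *)
Let evf_ker x : normal_closure S x -> evf x = one.
Proof.
move=> /(_ [set y | evf y = one]); apply; split; last first.
  move=> _ [h _ <-] /=; set a := free_product_inr G (i h).
  rewrite evfM; have -> : evf (free_product_inl G (i h)) = evf a.
    by rewrite [LHS]evf_pi [RHS]evf_pi /= !mulr1 f12.
  by rewrite -evfM mulgV evf1.
split; first split => /=.
- exact: evf1.
- by move=> y z; rewrite evfM => -> ->; rewrite mul1.
- by move=> y y1; rewrite -[LHS]mulr1 -y1 -evfM mulVg evf1.
move=> y g /= y1; rewrite /conjg !evfM y1 mul1 -evfM mulVg; exact: evf1.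
Qed.

(** The target is a mere monoid. This covers square matrices under [mulmx], whose unitarity is
    recovered afterwards, and permutations under the reversed product. *)
Lemma double_lift : exists f : group_double i -> T,
  [/\ {morph f : x y / (x * y)%g >-> mul x y},
      forall g, f (double_inl g) = f1 g & forall g, f (double_inr g) = f2 g].
Proof.
pose f (x : group_double i) := evf (repr (x : quotient_group S)).
have f_pi x : f (\pi_(quotient_group S) x) = evf x.
  have /evf_ker e := @coset_repr (free_product G G) S x.
  by rewrite -[RHS]mulr1 -e -evfM mulVKg.
exists f; split=> [x y|g|g].
- by rewrite [LHS]f_pi evfM.
- by rewrite f_pi evf_pi /= mulr1.
- by rewrite f_pi evf_pi /= mulr1.
Qed.

End UniversalProperty.
End GroupDouble.

(** * Finite rank and bounded corrections *)

(** Distinct basis elements are independent, so a basis exhausted by no finite list would contain r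
    + 1 independent elements. *)
Lemma finite_rank_freeg (K : choiceType) :
  finite_rank {freeg K / int} -> exists s : seq K, forall x, x \in s.
Proof.
move=> [r rP]; apply: contrapT => noseq.
have [s [us ss]] : exists s : seq K, uniq s /\ size s = r.+1.
  elim: r.+1 => [|n [s [us ss]]]; first by exists [::].
  have [x xs] : exists x, x \notin s.
    apply: contrapT => nx; apply: noseq; exists s => x.
    by apply: contrapT => xs; apply: nx; exists x; apply/negP.
  by exists (x :: s); rewrite /= xs us ss.
case: s us ss => // x0 s us ss.
suff /rP : Z_independent (fun k : 'I_r.+1 => << nth x0 (x0 :: s) k >> : {freeg K / int}).
  by rewrite ltnn.
move=> c c0 j; have := congr1 (coeff (nth x0 (x0 :: s) j)) c0.
rewrite coeff0 raddf_sum (bigD1 j) //= big1 => [|k kj].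
  by rewrite addr0 freegU_mulz coeffU eqxx mulr1 intz.
rewrite freegU_mulz coeffU nth_uniq ?ss //.
by rewrite (inj_eq val_inj) (negPf kj) mulr0.
Qed.

Definition l1norm (r : nat) (v : {ffun 'I_r -> int}) : nat := (\sum_i `|v i|)%N.

Section LinearCost.
Context (r : nat) (P : {ffun 'I_r -> int} -> nat -> Prop).
Hypothesis P_mono : forall v m n, (m <= n)%N -> P v m -> P v n.
Hypothesis P0 : P 0 0.
Hypothesis PD : forall v w m n, P v m -> P w n -> P (v + w) (m + n).
Hypothesis PN : forall v m, P v m -> P (- v) m.

Let PMz v m (q : int) : P v m -> P (v *~ q) (`|q| * m).
Proof.
move=> Pv; case: (intP q) => [|n|n]; first by rewrite mulr0z mul0n.
- elim: n.+1 => [|k IHk]; first by rewrite mulr0z mul0n.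
  by rewrite intS mulrzDr mulr1z /= mulSn; exact: PD.
- rewrite mulrNz abszN; apply: PN.
  elim: n.+1 => [|k IHk]; first by rewrite mulr0z mul0n.
  by rewrite intS mulrzDr mulr1z /= mulSn; exact: PD.
Qed.

Let l1normD (v w : {ffun 'I_r -> int}) : (l1norm (v + w)%R <= l1norm v + l1norm w)%N.
Proof.
rewrite /l1norm -big_split /=; apply: leq_sum => j _; rewrite ffunE.
by move: (v j) (w j) => a b; have := ler_normD a b; lia.
Qed.

Let ffunMzE (v : {ffun 'I_r -> int}) (q : int) j : (v *~ q) j = v j * q.
Proof.
case: (intP q) => [|n|n]; first by rewrite mulr0z mulr0 ffunE.
- by rewrite -pmulrn ffunMnE -mulr_natr natz.
- by rewrite mulrNz -pmulrn ffunE ffunMnE mulrN -mulr_natr natz.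
Qed.

(* Induction on the number of coordinates that may be nonzero: an element whose
   last such coordinate is nonzero and minimal clears that coordinate by
   Euclidean division, at a cost linear in the quotient. *)
Lemma linear_cost :
  exists C, forall v, (exists n, P v n) -> P v (C * l1norm v).
Proof.
suff H k : (k <= r)%N -> exists C, forall v, (exists n, P v n) ->
    (forall j : 'I_r, (k <= j)%N -> v j = 0) -> P v (C * l1norm v).
  have [C CP] := H r (leqnn r).
  by exists C => v Pv; apply: CP => // j; rewrite leqNgt ltn_ord.
elim: k => [_|k IHk kr].
  exists 0%N => v _ v0; rewrite mul0n; suff -> : v = 0 by [].
  by apply/ffunP => j; rewrite v0 ?ffunE.
have [C CP] := IHk (ltnW kr); pose kk := Ordinal kr.
(* The nonzero [k]-th coordinates, up to sign, of reachable vectors supported on the coordinates up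
   to [k]; the least one divides all the others. *)
pose Q d := exists w, [/\ exists n, P w n, forall j : 'I_r, (k < j)%N -> w j = 0,
  `|w kk|%N = d & w kk != 0].
have [[d Qd]|nQ] := pselect (exists d, Q d); last first.
  exists C => v Pv v0; apply: CP => // j kj.
  case: (ltngtP k j) kj => // [kj|kj] _; first exact: v0.
  apply: contrapT => /eqP vj; apply: nQ; exists `|v kk|%N, v; split => //.
  by have -> : kk = j by exact: val_inj.
have ex : exists d, `[< Q d >] by exists d; apply/asboolP.
case: (ex_minnP ex) => {d Qd ex} d /asboolP[w [[n Pw] w0 wd wk]] dmin.
(* As |q| is at most [l1norm v], the remainder v - q w has norm at most (1 + l1norm w) l1norm v, and
   q w itself costs at most n l1norm v. *)
exists (C * (1 + l1norm w) + n)%N => v Pv v0.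
pose q := (v kk %/ w kk)%Z; pose u : {ffun 'I_r -> int} := v - w *~ q.
have Pu : exists m, P u m.
  case: Pv => m Pv; exists (m + `|q| * n)%N.
  by apply: PD => //; apply/PN/PMz.
have u0 (j : 'I_r) : (k < j)%N -> u j = 0.
  by move=> kj; rewrite !ffunE ffunMzE v0 // w0 // mul0r subrr.
(* This coordinate is a remainder modulo [w kk], hence less than [d]; if nonzero, it would
   contradict the minimality of [d]. *)
have uk : u kk = 0.
  apply: contrapT => /eqP uk; have : (d <= `|u kk|)%N.
    by apply: dmin; apply/asboolP; exists u.
  have -> : u kk = (v kk %% w kk)%Z.
    by rewrite !ffunE ffunMzE /modz [in RHS]mulrC.
  have := ltz_mod (v kk) wk; have := modz_ge0 (v kk) wk; lia.
have qv : (`|q| <= l1norm v)%N.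
  apply: (@leq_trans `|v kk|); last by rewrite /l1norm (bigD1 kk) //= leq_addr.
  move: uk; rewrite !ffunE ffunMzE => /eqP; rewrite subr_eq0 => /eqP ->.
  by rewrite abszM leq_pmull //; lia.
have uv : (l1norm u <= l1norm v + l1norm v * l1norm w)%N.
  apply: leq_trans (l1normD _ _) _; rewrite leq_add2l.
  apply: (@leq_trans (`|q| * l1norm w)); last by rewrite leq_mul2r qv orbT.
  rewrite /l1norm big_distrr /=; apply: leq_sum => j _.
  by rewrite ffunE ffunMzE; nia.
have -> : v = u + w *~ q by rewrite /u subrK.
have Pu' : P u (C * l1norm u).
  apply: CP => // j; rewrite leq_eqVlt => /orP[/eqP kj|]; last exact: u0.
  by have <- : kk = j by exact: val_inj.
apply: P_mono (PD Pu' (PMz q Pw)); rewrite subrK; nia.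
Qed.

End LinearCost.

(* [O] is a class of finite objects of size [dim] with direct sums; [mult A m]
   means that the restriction of [A] decomposes with multiplicities [m]. *)
Lemma bounded_correction (r : nat) (O : Type) (dim : O -> nat)
    (mult : O -> ('I_r -> nat) -> Prop) :
  (exists A, dim A = 0%N /\ mult A (fun=> 0%N)) ->
  (forall A B, exists S, dim S = (dim A + dim B)%N /\ forall a b,
     mult A a -> mult B b -> mult S (fun j => a j + b j)%N) ->
  exists C, forall A1 A2 m0 m1 m2,
    mult A1 (fun j => m0 j + m1 j)%N -> mult A2 (fun j => m0 j + m2 j)%N ->
  exists B1 B2 b1 b2,
    [/\ mult B1 b1, mult B2 b2, forall j, (m1 j + b1 j = m2 j + b2 j)%N,
        (dim B1 <= C * (\sum_j m1 j + \sum_j m2 j))%N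
      & (dim B2 <= C * (\sum_j m1 j + \sum_j m2 j))%N].
Proof.
move=> [A0 [A0d A0m]] sum.
(* [v] is a difference of two objects of size at most [n]: negation becomes a swap and addition a
   direct sum. *)
pose P (v : {ffun 'I_r -> int}) n := exists B1 B2 b1 b2,
  [/\ mult B1 b1, mult B2 b2, (dim B1 <= n)%N, (dim B2 <= n)%N
    & forall j, v j + (b2 j)%:Z = (b1 j)%:Z].
have [||||C CP] := @linear_cost r P.
- move=> v m n mn [B1 [B2 [b1 [b2 [? ? ? ? ?]]]]]; exists B1, B2, b1, b2.
  by split => //; lia.
- exists A0, A0, (fun=> 0%N), (fun=> 0%N); rewrite A0d; split => // j.
  by rewrite ffunE.
- move=> v w m n [B1 [B2 [b1 [b2 [? ? ? ? vb]]]]] [D1 [D2 [d1 [d2 [? ? ? ? wd]]]]].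
  have [S1 [S1d S1m]] := sum B1 D1; have [S2 [S2d S2m]] := sum B2 D2.
  exists S1, S2, (fun j => b1 j + d1 j)%N, (fun j => b2 j + d2 j)%N.
  split; [exact: S1m|exact: S2m|lia|lia|].
  by move=> j; have := vb j; have := wd j; rewrite ffunE; move: (v j) (w j) => x y; lia.
- move=> v m [B1 [B2 [b1 [b2 [? ? ? ? vb]]]]]; exists B2, B1, b2, b1; split => //.
  by move=> j; have := vb j; rewrite ffunE; move: (v j) => x; lia.
exists C => A1 A2 m0 m1 m2 A1m A2m.
pose v := [ffun j => (m2 j)%:Z - (m1 j)%:Z] : {ffun 'I_r -> int}.
have /CP[B1 [B2 [b1 [b2 [? ? d1 d2 vb]]]]] : exists n, P v n.
  (* The given objects realize m2 - m1 because [m0] cancels. The cost is large, but only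
     reachability is asked for. *)
  exists (dim A1 + dim A2)%N, A2, A1, (fun j => m0 j + m2 j)%N, (fun j => m0 j + m1 j)%N.
  by split => // [||j]; rewrite ?ffunE; lia.
have vm : (l1norm v <= \sum_j m1 j + \sum_j m2 j)%N.
  by rewrite /l1norm -big_split /=; apply: leq_sum => j _; rewrite ffunE; lia.
exists B1, B2, b1, b2; split => //.
- by move=> j; have := vb j; rewrite ffunE; lia.
- by apply: leq_trans d1 _; rewrite leq_mul2l vm orbT.
- by apply: leq_trans d2 _; rewrite leq_mul2l vm orbT.
Qed.

(** * Multiplicities of finite actions *)

Lemma inj_surj_bij (X Y : Type) (f : X -> Y) :
  injective f -> (forall y, exists x, f x = y) -> bijective f.
Proof.
move=> f_inj /choice[g gK]; exists g => // x; exact/f_inj/gK.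
Qed.

(** One preimage is kept for each value that [f] attains. *)
Lemma finite_lifts (T : Type) (F : finType) (f : T -> F) :
  exists s : seq T, forall x, exists2 y, List.In y s & f x = f y.
Proof.
suff [s sP] : exists s : seq T, forall x, f x \in enum F ->
    exists2 y, List.In y s & f x = f y.
  by exists s => x; apply: sP; rewrite mem_enum.
elim: (enum F) => [|a e [s sP]]; first by exists [::].
have [[y ya]|na] := pselect (exists y, f y = a).
  exists (y :: s) => x; rewrite inE => /orP[/eqP xa|/sP[z zs xz]].
    by exists y; [left|rewrite xa].
  by exists z => //; right.
exists s => x; rewrite inE => /orP[/eqP xa|/sP //].
by case: na; exists x.
Qed.

Definition sum_map (X Y X' Y' : Type) (s : X -> X') (t : Y -> Y') (z : X + Y) :
    X' + Y' :=
  match z with inl x => inl (s x) | inr y => inr (t y) end.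

Lemma sum_map_inj (X Y X' Y' : Type) (s : X -> X') (t : Y -> Y') :
  injective s -> injective t -> injective (sum_map s t).
Proof. by move=> si ti [x|y] [x'|y'] //= [] => [/si|/ti] ->. Qed.

Definition sum_perm (X Y : finType) (s : {perm X}) (t : {perm Y}) :
    {perm (X + Y)} :=
  perm (sum_map_inj (@perm_inj _ s) (@perm_inj _ t)).

Section Actions.
Context (H : groupType).

Lemma is_action1 (X : finType) (a : H -> {perm X}) x :
  is_action_on a -> a 1%g x = x.
Proof. by move=> aP; apply: (@perm_inj _ (a 1%g)); rewrite -aP mulg1. Qed.

Lemma is_actionV (X : finType) (a : H -> {perm X}) h x :
  is_action_on a -> a (h^-1)%g (a h x) = x.
Proof. by move=> aP; rewrite -aP mulVg is_action1. Qed.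

(** [u] identifies [K] with an invariant subset; the restricted maps are injective, hence
    permutations of the finite set [K]. *)
Lemma pullback_action (X K : finType) (a : H -> {perm X}) (u : K -> X) :
  is_action_on a -> injective u -> (forall h k, exists k', u k' = a h (u k)) ->
  exists b : H -> {perm K},
    is_action_on b /\ forall h k, u (b h k) = a h (u k).
Proof.
move=> aP u_inj stab.
have /choice[f fE] h : exists f : K -> K, forall k, u (f k) = a h (u k).
  by have /choice[f fE] := stab h; exists f.
have f_inj h : injective (f h).
  by move=> k l /(congr1 u); rewrite !fE => /perm_inj; exact: u_inj.
exists (fun h => perm (@f_inj h)); split=> [g h k|h k]; last by rewrite permE.
by apply: u_inj; rewrite !permE !fE aP.
Qed.

Lemma sum_action (X Y : finType) (a : H -> {perm X}) (b : H -> {perm Y}) :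
  is_action_on a -> is_action_on b ->
  is_action_on (fun h => sum_perm (a h) (b h)).
Proof. by move=> aP bP g h [x|y]; rewrite !permE /= ?aP ?bP. Qed.

Definition equivariant (X Y : finType) (a : H -> {perm X}) (b : H -> {perm Y})
    (f : X -> Y) :=
  forall h x, f (a h x) = b h (f x).

Context (r : nat) (T : 'I_r -> transitive_action H).
Hypothesis TP : forall t : transitive_action H, exists j, act_iso t (T j).

Definition copies (m : 'I_r -> nat) : finType :=
  {j : 'I_r & ('I_(m j) * 'I_(act_size (T j)))%type}.

Definition copies_act m (h : H) (p : copies m) : copies m :=
  Tagged (fun j => ('I_(m j) * 'I_(act_size (T j)))%type)
    ((tagged p).1, act_perm (T (tag p)) h (tagged p).2).

Definition has_mult (X : finType) (a : H -> {perm X}) (m : 'I_r -> nat) :=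
  exists g : X -> copies m,
    bijective g /\ forall h x, g (a h x) = copies_act h (g x).

Lemma has_mult_iso (X Y : finType) (a : H -> {perm X}) (b : H -> {perm Y}) m :
  has_mult a m -> has_mult b m -> exists f, bijective f /\ equivariant a b f.
Proof.
move=> [f [f_bij fE]] [g [[g' gK g'K] gE]]; exists (g' \o f); split.
  by apply: bij_comp => //; exists g.
by move=> h x; apply: (can_inj gK); rewrite /= gE !g'K fE.
Qed.

Lemma has_mult0 (X : finType) (a : H -> {perm X}) :
  #|X| = 0%N -> has_mult a (fun=> 0%N).
Proof.
move=> X0; have nX (x : X) : False by have := card0_eq X0 x; rewrite inE.
exists (fun x => match nX x with end); split=> [|h x]; last by case: (nX x).
by apply: inj_surj_bij => [x|[j [[]]]//]; case: (nX x).
Qed.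

(** [Z] is only asked to be in equivariant bijection with the sum, so that this serves both disjoint
    unions and an invariant subset with its complement. *)
Lemma has_multD (X Y Z : finType) (a : H -> {perm X}) (b : H -> {perm Y})
    (c : H -> {perm Z}) (t : X + Y -> Z) m n :
  bijective t -> equivariant (fun h => sum_perm (a h) (b h)) c t ->
  has_mult a m -> has_mult b n -> has_mult c (fun j => m j + n j)%N.
Proof.
move=> [t' tK t'K] tE [f [f_bij fE]] [g [g_bij gE]].
pose u (z : X + Y) : copies (fun j => m j + n j)%N := match z with
  | inl x => Tagged (fun j => ('I_(m j + n j) * 'I_(act_size (T j)))%type)
      (lshift _ (tagged (f x)).1, (tagged (f x)).2)
  | inr y => Tagged (fun j => ('I_(m j + n j) * 'I_(act_size (T j)))%type)
      (rshift _ (tagged (g y)).1, (tagged (g y)).2)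
  end.
have uE h z : u (sum_perm (a h) (b h) z) = copies_act h (u z).
  by case: z => [x|y]; rewrite permE /= ?fE ?gE.
have u_bij : bijective u.
  apply: inj_surj_bij => [|[j [k y]]].
    case=> [x|y] [x'|y'] /=.
    - move: (bij_inj f_bij) => /(_ x x'); case: (f x) => j [k p].
      case: (f x') => j' [k' p'] /= + e; have ej := congr1 tag e; rewrite /= in ej.
      subst j'; move/eqP: e; rewrite eq_Tagged /= xpair_eqE => /andP[/eqP + /eqP ->].
      by move=> /lshift_inj -> ->.
    - case: (f x) => j [k p]; case: (g y') => j' [k' p'] /= e.
      have ej := congr1 tag e; rewrite /= in ej.
      subst j'; move/eqP: e; rewrite eq_Tagged /= xpair_eqE => /andP[+ _].
      by rewrite eq_lrshift.
    - case: (g y) => j [k p]; case: (f x') => j' [k' p'] /= e.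
      have ej := congr1 tag e; rewrite /= in ej.
      subst j'; move/eqP: e; rewrite eq_Tagged /= xpair_eqE => /andP[+ _].
      by rewrite eq_rlshift.
    - move: (bij_inj g_bij) => /(_ y y'); case: (g y) => j [k p].
      case: (g y') => j' [k' p'] /= + e; have ej := congr1 tag e; rewrite /= in ej.
      subst j'; move/eqP: e; rewrite eq_Tagged /= xpair_eqE => /andP[/eqP + /eqP ->].
      by move=> /rshift_inj -> ->.
  have [f' fK f'K] := f_bij; have [g' gK g'K] := g_bij.
  case: (split_ordP k) => k' ->.
    by exists (inl (f' (Tagged (fun j => ('I_(m j) * 'I_(act_size (T j)))%type)
      (k', y)))); rewrite /= f'K.
  by exists (inr (g' (Tagged (fun j => ('I_(n j) * 'I_(act_size (T j)))%type)
    (k', y)))); rewrite /= g'K.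
exists (u \o t'); split=> [|h z /=]; first by apply: bij_comp => //; exists t.
by rewrite -uE; congr u; rewrite -{1}(t'K z) -tE tK.
Qed.

Lemma sum_complement_bij (X K : finType) (u : K -> X) (p : pred X) :
  injective u -> (forall x, (exists k, u k = x) <-> p x) ->
  bijective (fun z : K + {x | ~~ p x} => match z with inl k => u k | inr x => val x end).
Proof.
move=> u_inj up; apply: inj_surj_bij => [[k|x] [k'|x'] /=|x].
- by move/u_inj ->.
- by move=> e; case/negP: (valP x'); apply/up; exists k.
- by move=> e; case/negP: (valP x); apply/up; exists k'.
- by move/val_inj ->.
case px: (p x); first by have /up[k <-] := px; exists (inl k).
by exists (inr (exist _ x (negbT px))).
Qed.

(** Strong induction on the size: the orbit of a point is isomorphic to some [T j], and what remains
    is smaller. The bound holds because every copy uses up at least one point. *)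
Lemma has_mult_exists (X : finType) (a : H -> {perm X}) :
  is_action_on a -> exists2 m, has_mult a m & (\sum_j m j <= #|X|)%N.
Proof.
have [n] := ubnP #|X|; elim: n => // n IHn in X a *; rewrite ltnS => Xn aP.
have [X0|] := posnP #|X|.
  by exists (fun=> 0%N); [exact: has_mult0|rewrite big1].
move=> /card_gt0P[x _]; pose A := [set y | `[< exists h, a h x = y >]]%SET.
have Ax : x \in A by rewrite inE; apply/asboolP; exists 1%g; rewrite is_action1.
have aA h y : (a h y \in A) = (y \in A).
  rewrite !inE; apply/asboolP/asboolP => -[g gy].
    by exists (h^-1 * g)%g; rewrite aP gy is_actionV.
  by exists (h * g)%g; rewrite aP gy.
(* The orbit is enumerated, since a [transitive_action] lives on an ordinal. *)
have [h k|b [bP bE]] := pullback_action aP (@enum_val_inj _ (mem A)).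
  have := enum_valP k; rewrite -(aA h) => hk; exists (enum_rank_in hk (a h (enum_val k))).
  by rewrite enum_rankK_in.
have A0 : (0 < #|A|)%N by apply/card_gt0P; exists x.
have bt k l : exists h, b h k = l.
  have := enum_valP k; have := enum_valP l.
  rewrite !inE => -[h hl] [g gk]; exists (h * g^-1)%g.
  by apply: enum_val_inj; rewrite bE -gk aP is_actionV.
have [j [f [f_bij fE]]] := TP (TransitiveAction bP A0 bt).
pose v (y : {y | ~~ (y \in A)}) := val y.
have [h k|c [cP cE]] := pullback_action aP (val_inj : injective v).
  have kA : ~~ (a h (v k) \in A) by rewrite aA (valP k).
  by exists (exist (fun y => ~~ (y \in A)) _ kA).
have KA : (#|{: {y | ~~ (y \in A)}}| < n)%N.
  rewrite card_sig; apply: leq_trans Xn; rewrite -(cardC (mem A)) /=.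
  by rewrite -[X in (X < _)%N]add0n ltn_add2r.
have [m cm mX] := IHn _ c KA cP.
exists (fun i => (i == j)%N + m i)%N.
  apply: has_multD (sum_complement_bij (p := mem A) (@enum_val_inj _ (mem A)) _) _ _ cm.
  - move=> y; split=> [[k <-]|yA]; first exact: enum_valP.
    by exists (enum_rank_in yA y); rewrite enum_rankK_in.
  - by move=> h [k|y]; rewrite permE /= ?bE // cE.
  have jj : (0 < (j == j))%N by rewrite eqxx.
  exists (fun k => Tagged (fun i => ('I_(i == j) * 'I_(act_size (T i)))%type)
    (Ordinal jj, f k)); split=> [|h k]; last by rewrite fE.
  apply: inj_surj_bij => [k l /eqP|[i [k y]]].
    by rewrite eq_Tagged /= xpair_eqE => /andP[_ /eqP/(bij_inj f_bij)].
  have ij : i = j.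
    by apply: contrapT => /eqP/negPf ij; case: k => k /=; rewrite ij.
  subst i; have [f' fK f'K] := f_bij; exists (f' y); rewrite f'K.
  suff <- : Ordinal jj = k by [].
  by apply: val_inj; case: k => k /=; rewrite eqxx; case: k.
rewrite big_split /= (bigD1 j) //= eqxx big1 ?addn0 => [|i /negPf -> //].
rewrite -(cardC (mem A)) leq_add // (leq_trans mX) // card_sig.
by apply: eq_leq; apply: eq_card => y; rewrite !inE.
Qed.

End Actions.

(** * Amalgamating permutation actions *)

Lemma restrict_action (G H : groupType) (i : {multiplicative H -> G})
    (X : finType) (a : G -> {perm X}) :
  is_action_on a -> is_action_on (fun h => a (i h)).
Proof. by move=> aP g h x; rewrite gmulfM aP. Qed.

(** Union bound over the list [s]. *)
Lemma card_has_le (X : finType) (I : Type) (s : seq I) (p : I -> pred X)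
    (q : pred X) :
  (forall x, q x -> exists2 k, List.In k s & p k x) ->
  (#|q| <= \sum_(k <- s) #|p k|)%N.
Proof.
elim: s q => [|k s IHs] q qs.
  by rewrite big_nil leqn0; apply/eqP/eq_card0 => x; apply/negP => /qs[].
rewrite big_cons -(cardID (p k) q); apply: leq_add.
  by apply: subset_leq_card; apply/fintype.subsetP => x; rewrite !inE => /andP[].
apply: IHs => x; rewrite inE => /andP[/negP npx /qs[l [<- //|ls] pl]].
by exists l.
Qed.

Section Amalgamation.
Context (G H : groupType) (i : {multiplicative H -> G}).
Context (r : nat) (T : 'I_r -> transitive_action H).
Hypothesis TP : forall t : transitive_action H, exists j, act_iso t (T j).

(** [bounded_correction] speaks of a single type of objects, so finite [G]-sets are bundled with
    their carriers. *)
Let obj := {X : finType & {a : G -> {perm X} | is_action_on a}}.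
Let mk (X : finType) (a : G -> {perm X}) (aP : is_action_on a) : obj :=
  existT _ X (exist _ a aP).
Let dim (A : obj) := #|projT1 A|.
Let mult (A : obj) m := has_mult T (fun h => sval (projT2 A) (i h)) m.

Let correction : exists C, forall A1 A2 m0 m1 m2,
    mult A1 (fun j => m0 j + m1 j)%N -> mult A2 (fun j => m0 j + m2 j)%N ->
  exists B1 B2 b1 b2,
    [/\ mult B1 b1, mult B2 b2, forall j, (m1 j + b1 j = m2 j + b2 j)%N,
        (dim B1 <= C * (\sum_j m1 j + \sum_j m2 j))%N
      & (dim B2 <= C * (\sum_j m1 j + \sum_j m2 j))%N].
Proof.
apply: bounded_correction => [|[X [a aP]] [Y [b bP]]].
  have vP : is_action_on (fun _ : G => 1%g : {perm void}) by move=> g h [].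
  exists (mk vP); rewrite /dim /= card_void; split => //.
  by apply: has_mult0; rewrite card_void.
exists (mk (sum_action aP bP)); split.
  by rewrite /dim /= card_sum.
move=> m n; rewrite /mult /=; apply: (has_multD (t := id)); first by exists id.
by [].
Qed.

(* How an element of [H] acts on one copy of each transitive action determines
   how it acts on every finite [H]-set. *)
Let lifts : exists s : seq H, forall h, exists2 k, List.In k s &
  forall (X : finType) (a : H -> {perm X}), is_action_on a -> a h = a k.
Proof.
pose F := {ffun copies T (fun=> 1%N) -> copies T (fun=> 1%N)}.
have [s sP] := finite_lifts (fun h => [ffun p => copies_act h p] : F).
exists s => h; have [k ks hk] := sP h; exists k => // X a aP.
have E j : act_perm (T j) h = act_perm (T j) k.
  apply/permP => y.
  move/ffunP/(_ (Tagged (fun j => ('I_1 * 'I_(act_size (T j)))%type) (ord0, y))): hk.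
  by rewrite !ffunE => /eqP; rewrite eq_Tagged /= xpair_eqE => /andP[_ /eqP].
have [m [g [g_bij gE]] _] := has_mult_exists TP aP.
apply/permP => x; apply: (bij_inj g_bij); rewrite !gE.
by rewrite /copies_act E.
Qed.


Let bad (X Y : finType) (a : G -> {perm Y}) (j : X -> Y) (f : {perm X}) g :=
  [pred x | j (f x) != a g (j x)].

(** [N] bounds at once the excess sizes and the defects on the finite test list [s]. The outcome is
    asymmetric: [b1] is [a1] plus a summand and loses nothing, whereas [b2] is [a2] plus a summand,
    conjugated by a bijection that matches [j1] with [j2] only on most of [X]. *)
Lemma amalgamate_actions : exists C (s : seq H),
  forall (X Y1 Y2 : finType) (j1 : X -> Y1) (j2 : X -> Y2) (phi : H -> {perm X})
    (a1 : G -> {perm Y1}) (a2 : G -> {perm Y2}) (N : nat),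
  injective j1 -> injective j2 -> is_action_on a1 -> is_action_on a2 ->
  (#|Y1| - #|X| + (#|Y2| - #|X|) + \sum_(h <- s)
    (#|bad a1 j1 (phi h) (i h)| + #|bad a2 j2 (phi h) (i h)|) <= N)%N ->
  exists (Y : finType) (j : X -> Y) (b1 b2 : G -> {perm Y}),
  [/\ [/\ injective j, is_action_on b1, is_action_on b2 &
        forall h y, b1 (i h) y = b2 (i h) y],
      (#|Y| <= #|X| + C * N)%N,
      forall f g, (#|bad b1 j f g| <= #|bad a1 j1 f g|)%N
    & forall f g, (#|bad b2 j f g| <= #|bad a2 j2 f g| + C * N)%N].
Proof.
have [C CP] := correction; have [s sP] := lifts.
(* The two complements of [K0] have at most 2 N points together, hence [B1] at most 2 C N. The
   excess of [Y1] adds [N] to the size; the points [x] with [x] or [f x] outside [Z] add 2 N to the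
   defect. *)
exists (2 * C + 2)%N, s => X Y1 Y2 j1 j2 phi a1 a2 N j1i j2i a1P a2P NE.
(* The points whose [H]-translates in [Y1] and in [Y2] come from the same points of [X]; asking this
   for every [h] makes [Z] stable under [H]. *)
pose Z := [set x | `[< forall h, exists x',
  j1 x' = a1 (i h) (j1 x) /\ j2 x' = a2 (i h) (j2 x) >]]%SET.
have ZP x : x \in Z -> forall h, exists x',
    j1 x' = a1 (i h) (j1 x) /\ j2 x' = a2 (i h) (j2 x).
  by rewrite inE => /asboolP.
have a1H := restrict_action i a1P; have a2H := restrict_action i a2P.
(* Outside [Z] some [h] fails, and so does the element of [s] that acts like [h]; the point is then
   bad for that element. *)
have cZ : (#|[pred x | x \notin Z]| + (#|Y1| - #|X| + (#|Y2| - #|X|)) <= N)%N.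
  rewrite addnC; apply: leq_trans NE; rewrite leq_add2l.
  apply: leq_trans (card_has_le (s := s) (p := fun h => [pred x |
    bad a1 j1 (phi h) (i h) x || bad a2 j2 (phi h) (i h) x]) _) _.
    move=> x /=; rewrite inE => /asboolP; apply: contra_notP => nb h.
    have [k ks hk] := sP h; exists (phi k x); rewrite (hk _ _ a1H) (hk _ _ a2H).
    by split; apply/eqP; apply: contrapT => /negP b; apply: nb; exists k => //=;
      rewrite b ?orbT.
  apply: leq_sum => h _; rewrite -cardUI; apply: leq_trans (leq_addr _ _).
  by apply: subset_leq_card; apply/fintype.subsetP => x; rewrite !inE.
pose K0 : finType := {x | x \in Z}.
pose u1 (k : K0) := j1 (val k); pose u2 (k : K0) := j2 (val k).
have u1i : injective u1 by move=> k l /j1i/val_inj.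
have u2i : injective u2 by move=> k l /j2i/val_inj.
have stab h (k : K0) : exists k' : K0,
    u1 k' = a1 (i h) (u1 k) /\ u2 k' = a2 (i h) (u2 k).
  have [x [x1 x2]] := ZP _ (valP k) h.
  have xZ : x \in Z.
    rewrite inE; apply/asboolP => g; have [y [y1 y2]] := ZP _ (valP k) (g * h)%g.
    by exists y; rewrite x1 x2 y1 y2 gmulfM a1P a2P.
  by exists (exist _ x xZ).
have [|c [cP c1]] := pullback_action a1H u1i.
  by move=> h k; have [k' [k1 _]] := stab h k; exists k'.
have c2 h k : u2 (c h k) = a2 (i h) (u2 k).
  have [k' [k1 <-]] := stab h k; congr u2; apply: u1i.
  by rewrite c1 k1.
have rest (Y : finType) (a : G -> {perm Y}) (u : K0 -> Y) :
    is_action_on a -> injective u -> (forall h k, u (c h k) = a (i h) (u k)) ->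
    exists (K : finType) (v : K -> Y) (b : H -> {perm K}),
    [/\ is_action_on b, #|K| = (#|Y| - #|K0|)%N &
      bijective (fun z : K0 + K => match z with inl k => u k | inr k => v k end)
      /\ forall h k, v (b h k) = a (i h) (v k)].
  move=> aP ui uE; pose p y := `[< exists k, u k = y >].
  have up y : (exists k, u k = y) <-> p y by split=> /asboolP.
  have vi : injective (val : {y | ~~ p y} -> Y) := val_inj.
  have [h k|b [bP bE]] := pullback_action (restrict_action i aP) vi.
    have q : ~~ p (a (i h) (val k)).
      apply: contra (valP k) => /asboolP[l lk]; apply/asboolP.
      exists (c (h^-1)%g l); rewrite uE lk; exact: (is_actionV _ _ (restrict_action i aP)).
    by exists (exist (fun y => ~~ p y) _ q).
  exists _, (val : {y | ~~ p y} -> Y), b; split; [exact: bP| |].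
    by rewrite -(bij_eq_card (sum_complement_bij ui up)) card_sum addKn.
  by split; [exact: (sum_complement_bij ui up)|exact: bE].
have [K1 [v1 [d1 [d1P cK1 [t1 d1E]]]]] := rest _ _ _ a1P u1i c1.
have [K2 [v2 [d2 [d2P cK2 [t2 d2E]]]]] := rest _ _ _ a2P u2i c2.
have [m0 m0P _] := has_mult_exists TP cP.
have [m1 m1P m1K] := has_mult_exists TP d1P.
have [m2 m2P m2K] := has_mult_exists TP d2P.
have cK0 : (#|K0| + #|[pred x | x \notin Z]| = #|X|)%N.
  by rewrite card_sig -(cardC (mem Z)).
have XY1 : (#|X| <= #|Y1|)%N := leq_card _ j1i.
have XY2 : (#|X| <= #|Y2|)%N := leq_card _ j2i.
have M1 : mult (mk a1P) (fun j => m0 j + m1 j)%N.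
  by apply: (has_multD t1 _ m0P m1P) => h [k|k]; rewrite permE /= ?c1 ?d1E.
have M2 : mult (mk a2P) (fun j => m0 j + m2 j)%N.
  by apply: (has_multD t2 _ m0P m2P) => h [k|k]; rewrite permE /= ?c2 ?d2E.
have [[B1 [e1 e1P]] [[B2 [e2 e2P]] [n1 [n2 [n1P n2P mn dB1 _]]]]] := CP _ _ _ _ _ M1 M2.
have [W [W_bij WE]] : exists W : (K1 + B1)%type -> (K2 + B2)%type, bijective W /\
    equivariant (fun h => sum_perm (d1 h) (e1 (i h)))
                (fun h => sum_perm (d2 h) (e2 (i h))) W.
  apply: (@has_mult_iso _ _ T _ _ _ _ (fun j => m1 j + n1 j)%N).
    by apply: (has_multD (t := id)) m1P n1P; [exists id|].
  have -> : (fun j => m1 j + n1 j)%N = (fun j => m2 j + n2 j)%N by apply/funext.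
  by apply: (has_multD (t := id)) m2P n2P; [exists id|].
(* Reassociation: [Y] is partitioned into the images of [K0] and [K], and [B] is joined to [K] so
   that [W] can act on K + B. *)
pose P (Y K B : finType) (u : K0 -> Y) (v : K -> Y) (z : K0 + (K + B)) : (Y + B)%type :=
  match z with inl k => inl (u k) | inr w => sum_map v id w end.
have glue (Y K B : finType) (u : K0 -> Y) (v : K -> Y) :
    bijective (fun z : K0 + K => match z with inl k => u k | inr k => v k end) ->
    bijective (@P Y K B u v).
  move=> [t' tK t'K].
  exists (fun z => match z with
    | inl y => match t' y with inl k => inl k | inr k => inr (inl k) end
    | inr b => inr (inr b) end).
    by case=> [k|[k|b]] //=; [rewrite (tK (inl k))|rewrite (tK (inr k))].
  by case=> [y|b] //=; have := t'K y; case: (t' y) => k /= <-.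
have [P1' P1K P1'K] := glue _ _ B1 _ _ t1.
have P1E h z : P _ _ B1 u1 v1 (match z with inl k => inl (c h k)
    | inr w => inr (sum_perm (d1 h) (e1 (i h)) w) end) =
    sum_perm (a1 (i h)) (e1 (i h)) (P _ _ B1 u1 v1 z).
  by case: z => [k|[k|b]]; rewrite !permE /= ?c1 ?permE /= ?d1E.
have P2E h z : P _ _ B2 u2 v2 (match z with inl k => inl (c h k)
    | inr w => inr (sum_perm (d2 h) (e2 (i h)) w) end) =
    sum_perm (a2 (i h)) (e2 (i h)) (P _ _ B2 u2 v2 z).
  by case: z => [k|[k|b]]; rewrite !permE /= ?c2 ?permE /= ?d2E.
(* The identity on [K0] and [W] on the rest, so that [V] commutes with [H] and sends [j1 x] to
   [j2 x] for [x] in [Z]. *)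
pose V z := P _ _ B2 u2 v2 (sum_map id W (P1' z)).
have [V' VK V'K] : bijective V.
  apply: bij_comp (glue _ _ B2 _ _ t2) _; apply: bij_comp; last first.
    by exists (P _ _ B1 u1 v1).
  have [W' WK W'K] := W_bij; exists (sum_map id W').
    by case=> [k|w] //=; rewrite WK.
  by case=> [k|w] //=; rewrite W'K.
have VE h z : V (sum_perm (a1 (i h)) (e1 (i h)) z) =
    sum_perm (a2 (i h)) (e2 (i h)) (V z).
  rewrite -{1}(P1'K z) -P1E /V P1K -P2E; congr (P _ _ _ _ _ _).
  by case: (P1' z) => [k|w] //=; rewrite WE.
have VZ x : x \in Z -> V (inl (j1 x)) = inl (j2 x).
  by move=> xZ; rewrite /V (P1K (inl (exist _ x xZ))).
have b2i g : injective (fun z => V' (sum_perm (a2 g) (e2 g) (V z))).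
  by move=> z w /(can_inj V'K)/perm_inj/(can_inj VK).
exists (Y1 + B1)%type, (inl \o j1), (fun g => sum_perm (a1 g) (e1 g)),
  (fun g => perm (@b2i g)); split.
- split=> [x y [/j1i]||g h z|h z] //.
  + exact: sum_action.
  + by rewrite !(permE (@b2i _)) V'K (sum_action a2P e2P).
  + by rewrite [in RHS]permE -VE VK.
- have mN : (\sum_j m1 j + \sum_j m2 j <= 2 * N)%N.
    by rewrite cK1 in m1K; rewrite cK2 in m2K; lia.
  have := leq_trans dB1 (leq_mul (leqnn C) mN); rewrite card_sum /dim /=.
  rewrite mulnA [(C * 2)%N]mulnC mulnDl => dB.
  have Y1N : (#|Y1| <= #|X| + N)%N by lia.
  by apply: leq_trans (leq_add Y1N dB) _; rewrite -addnA leq_add2l; nia.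
- move=> f g; apply: subset_leq_card; apply/fintype.subsetP => x; rewrite !inE permE /=.
  by apply: contra => /eqP ->.
(* [f] permutes [X], so as many points are sent outside [Z] as lie there. *)
move=> f g; have cfZ : #|[pred x | f x \notin Z]| = #|[pred x | x \notin Z]|.
  rewrite -(fintype.card_image (@perm_inj _ f)).
  apply: eq_card => x; apply/fintype.imageP/idP => [[y + ->]|]; rewrite !inE // => xZ.
  by exists (f^-1%g x); rewrite ?inE permKV.
apply: (@leq_trans (#|bad a2 j2 f g| +
  (#|[pred x | x \notin Z]| + #|[pred x | f x \notin Z]|))).
  apply: leq_trans (card_has_le (s := [:: bad a2 j2 f g; [pred x | x \notin Z];
    [pred x | f x \notin Z]]) (p := id) _) _; last by rewrite !big_cons big_nil addn0.
  move=> x; rewrite inE /= permE => xb.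
  have [xZ|nZ] := boolP (x \in Z); last first.
    by exists [pred x | x \notin Z]; [right; left|].
  have [fxZ|nZ] := boolP (f x \in Z); last first.
    by exists [pred x | f x \notin Z]; [right; right; left|].
  exists (bad a2 j2 f g); first by left.
  move: xb; apply: contra => /= /eqP jf; apply/eqP/(can_inj VK).
  by rewrite V'K !VZ // permE /= jf.
by rewrite leq_add2l cfZ; nia.
Qed.

End Amalgamation.

(** * Permutation stability of the double *)

(** Choice for types varying with [n], as the carriers do. *)
Lemma exists_section (T : nat -> Type) (P : forall n, T n -> Prop) :
  (forall n, exists x, P n x) -> exists f : forall n, T n, forall n, P n (f n).
Proof. by move=> /(_ _)/cid PT; exists (fun n => sval (PT n)) => n; exact: svalP. Qed.

Section Limits.
Context (R : realType).

Lemma le_cvg0 (u v : nat -> R) :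
  (forall n, 0 <= u n <= v n) -> v n @[n --> \oo] --> (0 : R) ->
  u n @[n --> \oo] --> (0 : R).
Proof.
move=> uv v0; apply: squeeze_cvgr v0; last exact: cvg_cst.
by apply: nearW.
Qed.

Lemma le_cvg1 (u v : nat -> R) :
  (forall n, 1 <= u n <= 1 + v n) -> v n @[n --> \oo] --> (0 : R) ->
  u n @[n --> \oo] --> (1 : R).
Proof.
move=> uv v0; apply: (@squeeze_cvgr _ _ _ _ (fun=> 1) (fun n => 1 + v n)).
- by apply: nearW.
- exact: cvg_cst.
- by rewrite -[X in _ --> X]addr0; apply: cvgD => //; exact: cvg_cst.
Qed.

Lemma cvg0D (u v : nat -> R) :
  u n @[n --> \oo] --> (0 : R) -> v n @[n --> \oo] --> (0 : R) ->
  u n + v n @[n --> \oo] --> (0 : R).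
Proof. by move=> u0 v0; rewrite -[X in _ --> X]addr0; exact: cvgD. Qed.

Lemma cvg0M (k : R) (u : nat -> R) :
  u n @[n --> \oo] --> (0 : R) -> k * u n @[n --> \oo] --> (0 : R).
Proof. by move=> u0; rewrite -[X in _ --> X](mulr0 k); exact: cvgMr. Qed.

Lemma cvg0_sum (I : Type) (s : seq I) (u : I -> nat -> R) :
  (forall k, u k n @[n --> \oo] --> (0 : R)) ->
  (\sum_(k <- s) u k n) @[n --> \oo] --> (0 : R).
Proof.
move=> u0; elim: s => [|k s IHs].
  by under eq_fun do rewrite big_nil; exact: cvg_cst.
by under eq_fun do rewrite big_cons; exact: cvg0D.
Qed.

End Limits.

Section StableP.
Context (R : realType) (G H : groupType) (i : {multiplicative H -> G}).

Lemma double_action (Y : finType) (b1 b2 : G -> {perm Y}) :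
  is_action_on b1 -> is_action_on b2 -> (forall h y, b1 (i h) y = b2 (i h) y) ->
  exists psi : group_double i -> {perm Y}, [/\ is_action_on psi,
    forall g, psi (double_inl i g) = b1 g & forall g, psi (double_inr i g) = b2 g].
Proof.
move=> b1P b2P b12.
(* The product of permutations is opposite to the composition of maps, hence the reversed
   multiplication. *)
have [||||||||f [fM f1 f2]] := @double_lift _ _ i {perm Y} 1%g (fun s t => (t * s)%g) b1 b2.
- by move=> s t u; rewrite mulgA.
- by move=> s; rewrite mulg1.
- by move=> s; rewrite mul1g.
- by apply/permP => y; rewrite is_action1 // perm1.
- by move=> g h; apply/permP => y; rewrite permM b1P.
- by apply/permP => y; rewrite is_action1 // perm1.
- by move=> g h; apply/permP => y; rewrite permM b2P.
- by move=> h; apply/permP => y; exact: b12.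
by exists f; split => // g h y; rewrite fM permM.
Qed.

Lemma flexibly_P_stable_double :
  finite_rank {freeg (Irr_P H) / int} -> flexibly_P_stable R G ->
  flexibly_P_stable R (group_double i).
Proof.
move=> /finite_rank_freeg[irr irrP] G_stable X phi X0 phiM.
pose T (j : 'I_(size irr)) : transitive_action H := repr (tnth (in_tuple irr) j).
have TP t : exists j, act_iso t (T j).
  have /(nthP (\pi_(Irr_P H) t))[k ks kt] := irrP (\pi_(Irr_P H) t).
  exists (Ordinal ks); apply/asboolP; suff : act_iso_rel t (T (Ordinal ks)) by [].
  rewrite -[act_iso_rel _ _]eqmodE reprK (tnth_nth (\pi_(Irr_P H) t)) /=.
  by rewrite kt.
have [C [s sP]] := amalgamate_actions i TP.
have stab (e : G -> group_double i) : {morph e : x y / (x * y)%g} ->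
    exists (Y : nat -> finType) (j : forall n, X n -> Y n)
      (psi : forall n, G -> {perm Y n}),
    [/\ forall n, injective (j n),
        (#|Y n|%:R / #|X n|%:R : R) @[n --> \oo] --> (1 : R),
        forall n, is_action_on (psi n)
      & forall g, proportion R [pred x : X n | j n (phi n (e g) x) != psi n g (j n x)]
                    @[n --> \oo] --> (0 : R)].
  move=> eM; apply: (G_stable X (fun n g => phi n (e g)) X0) => g h.
  by have := phiM (e g) (e h); rewrite -eM.
have [Y1 [j1 [a1 [j1i Y1X a1P a1phi]]]] := stab _ (@double_inlM _ _ i).
have [Y2 [j2 [a2 [j2i Y2X a2P a2phi]]]] := stab _ (@double_inrM _ _ i).
(* Both defects use [double_inl]: the two copies of [h] coincide in the double, so one family of
   permutations of [X n] tests both actions. *)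
pose N n := (#|Y1 n| - #|X n| + (#|Y2 n| - #|X n|) + \sum_(h <- s)
  (#|[pred x | j1 n (phi n (double_inl i (i h)) x) != a1 n (i h) (j1 n x)]| +
   #|[pred x | j2 n (phi n (double_inl i (i h)) x) != a2 n (i h) (j2 n x)]|))%N.
have XR n : (0 : R) < #|X n|%:R by rewrite ltr0n X0.
have N0 : (N n)%:R / #|X n|%:R @[n --> \oo] --> (0 : R).
  have sub0 (Y : nat -> finType) (j : forall n, X n -> Y n) :
      (forall n, injective (j n)) ->
      (#|Y n|%:R / #|X n|%:R : R) @[n --> \oo] --> (1 : R) ->
      (#|Y n| - #|X n|)%:R / #|X n|%:R @[n --> \oo] --> (0 : R).
    move=> ji YX; have -> : (fun n => (#|Y n| - #|X n|)%:R / #|X n|%:R : R) =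
        (fun n => #|Y n|%:R / #|X n|%:R - 1).
      apply/funext => n; rewrite natrB ?(leq_card _ (ji n)) // mulrBl divff //.
      by rewrite gt_eqF.
    by rewrite -(subrr (1 : R)); apply: cvgB => //; exact: cvg_cst.
  under eq_fun do rewrite !natrD !mulrDl natr_sum mulr_suml.
  apply: cvg0D; first by apply: cvg0D; apply: sub0; eassumption.
  apply: cvg0_sum => h; under eq_fun do rewrite natrD mulrDl.
  by apply: cvg0D; [exact: a1phi|rewrite double_inl_inr; exact: a2phi].
(* Set, embedding and action are packed together so that they can be chosen at once for every
   [n]. *)
have D n : exists D : {Y : finType & ((X n -> Y) * (group_double i -> {perm Y}))%type},
  let j := (projT2 D).1 in let psi := (projT2 D).2 in
  [/\ injective j, is_action_on psi, (#|projT1 D| <= #|X n| + C * N n)%N &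
    forall g,
    (#|[pred x | j (phi n (double_inl i g) x) != psi (double_inl i g) (j x)]| <=
     #|[pred x | j1 n (phi n (double_inl i g) x) != a1 n g (j1 n x)]|)%N /\
    (#|[pred x | j (phi n (double_inr i g) x) != psi (double_inr i g) (j x)]| <=
     #|[pred x | j2 n (phi n (double_inr i g) x) != a2 n g (j2 n x)]| + C * N n)%N].
  have [Y [j [b1 [b2 [[ji b1P b2P b12] YX B1 B2]]]]] :=
    sP _ _ _ _ _ (fun h => phi n (double_inl i (i h))) _ _ _
      (j1i n) (j2i n) (a1P n) (a2P n) (leqnn (N n)).
  have [psi [psiP psi1 psi2]] := double_action b1P b2P b12.
  exists (existT _ Y (j, psi)); split => //= g; rewrite psi1 psi2.
  by split; [exact: B1|exact: B2].
have [f DP] := exists_section D.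
exists (fun n => projT1 (f n)), (fun n => (projT2 (f n)).1),
  (fun n => (projT2 (f n)).2).
have CN0 : C%:R * ((N n)%:R / #|X n|%:R) @[n --> \oo] --> (0 : R) by exact: cvg0M.
split=> [n||n|]; [by have [] := DP n| |by have [] := DP n|].
  apply: le_cvg1 CN0 => n; have [ji _ YX _] := DP n.
  rewrite ler_pdivlMr // mul1r ler_nat (leq_card _ ji) /=.
  rewrite ler_pdivrMr // mulrDl mul1r -mulrA divfK ?gt_eqF //.
  by rewrite -natrM -natrD ler_nat.
apply: double_ind => [g|g|x y].
- apply: le_cvg0 (a1phi g) => n; have [_ _ _ /(_ g)[le1 _]] := DP n.
  by rewrite /proportion divr_ge0 ?ler0n //= ler_pM2r ?invr_gt0 // ler_nat.
- apply: le_cvg0 (cvg0D (a2phi g) CN0) => n; have [_ _ _ /(_ g)[_ le2]] := DP n.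
  rewrite /proportion divr_ge0 ?ler0n //= mulrA -mulrDl ler_pM2r ?invr_gt0 //.
  by rewrite -natrM -natrD ler_nat.
(* The defect at a product is at most the defect of [phi] at the pair, plus that of [x] read at the
   points [phi n y z], plus that of [y]; the bijection [phi n y] preserves the second count. *)
move=> Px Py; apply: le_cvg0 (cvg0D (phiM x y) (cvg0D Px Py)) => n.
have [ji psiP _ _] := DP n; move: ji psiP.
move: (f n) => [Y [j psi]] /= ji psiP.
rewrite /proportion divr_ge0 ?ler0n //= -!mulrDl ler_pM2r ?invr_gt0 //.
rewrite -!natrD ler_nat.
pose q := [pred z | j (phi n x (phi n y z)) != psi x (j (phi n y z))].
have -> : #|[pred z | j (phi n x z) != psi x (j z)]| = #|q|.
  rewrite -(fintype.card_image (@perm_inj _ (phi n y)) q).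
  apply: eq_card => z; apply/idP/fintype.imageP => [|[w + ->]]; rewrite !inE // => zq.
  by exists ((phi n y)^-1%g z); rewrite ?inE permKV.
apply: leq_trans (card_has_le (s := [:: [pred z | phi n x (phi n y z) != phi n (x * y)%g z];
  q; [pred z | j (phi n y z) != psi y (j z)]]) (p := id) _) _; last first.
  by rewrite !big_cons big_nil addn0.
move=> z /= nz; apply: contrapT => nk; case/negP: nz.
have E p : List.In p [:: [pred z | phi n x (phi n y z) != phi n (x * y)%g z];
  q; [pred z | j (phi n y z) != psi y (j z)]] -> ~~ p z.
  by move=> pl; apply/negP => pz; apply: nk; exists p.
have /negPn/eqP <- := E _ (or_introl erefl).
have /negPn/eqP -> := E _ (or_intror (or_introl erefl)).
have /negPn/eqP -> := E _ (or_intror (or_intror (or_introl erefl))).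
by rewrite psiP.
Qed.
End StableP.

(** * The Frobenius norm *)

Section Frobenius.
Context (R : realType).
Local Notation C := R[i].
Local Notation Re := complex.Re.

Lemma ReD (x y : C) : Re (x + y) = Re x + Re y.
Proof. by case: x y => [a b] [c d]. Qed.

Lemma ReN (x : C) : Re (- x) = - Re x.
Proof. by case: x. Qed.

Lemma Re_sum (I : Type) (s : seq I) (P : pred I) (F : I -> C) :
  Re (\sum_(k <- s | P k) F k) = \sum_(k <- s | P k) Re (F k).
Proof. by elim/big_rec2: _ => //= k x y _ <-; rewrite ReD. Qed.

Lemma Re_conjC (x : C) : Re (Num.conj_op x) = Re x.
Proof. by case: x. Qed.

Lemma Re_nat n : Re (n%:R : C) = n%:R.
Proof. by elim: n => // n IHn; rewrite -!natr1 ReD IHn. Qed.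

Lemma Re_natr_div (x : C) (n : nat) : Re (x / n%:R) = Re x / n%:R.
Proof.
case: n => [|n]; first by rewrite invr0 mulr0 invr0 mulr0.
have n0 : (n.+1%:R : C) != 0 by rewrite pnatr_eq0.
apply: (mulIf (_ : n.+1%:R != 0 :> R)); rewrite ?pnatr_eq0 // divfK ?pnatr_eq0 //.
rewrite -{2}(divfK n0 x); set y := x / _.
by rewrite !mulr_natr; elim: n.+1 => // k IHk; rewrite !mulrS ReD IHk.
Qed.

Lemma Re_normsq (x : C) : Re (Num.conj_op x * x) = Re x ^+ 2 + complex.Im x ^+ 2.
Proof. by case: x => a b; rewrite /= mulNr opprK !expr2. Qed.

Lemma trmxC_mul m n p (A : 'M[C]_(m, n)) (B : 'M[C]_(n, p)) :
  (A *m B)^t* = B^t* *m A^t*.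
Proof. by rewrite trmx_mul map_mxM. Qed.

Lemma trmxC_add m n (A B : 'M[C]_(m, n)) : (A + B)^t* = A^t* + B^t*.
Proof. by rewrite linearD /= map_mxD. Qed.

Lemma trmxC_opp m n (A : 'M[C]_(m, n)) : (- A)^t* = - A^t*.
Proof. by rewrite linearN /= map_mxN. Qed.

Lemma trmxC_sub m n (A B : 'M[C]_(m, n)) : (A - B)^t* = A^t* - B^t*.
Proof. by rewrite trmxC_add trmxC_opp. Qed.

Lemma trmxC_sum m n (I : Type) (s : seq I) (P : pred I) (F : I -> 'M[C]_(m, n)) :
  (\sum_(k <- s | P k) F k)^t* = \sum_(k <- s | P k) (F k)^t*.
Proof.
elim/big_rec2: _ => [|k x y _ <-]; first by rewrite trmx0 map_mx0.
by rewrite trmxC_add.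
Qed.

Lemma trmxC1 n : (1%:M : 'M[C]_n)^t* = 1%:M.
Proof. by rewrite trmx1 map_mx1. Qed.

Lemma trmxC0 m n : (0 : 'M[C]_(m, n))^t* = 0.
Proof. by rewrite trmx0 map_mx0. Qed.

(** The real Hilbert-Schmidt inner product, without normalization; [fro] is the square of its norm.
    On this scale an isometry weighs the dimension of its source, so distances and dimensions add up
    in the same inequalities. *)
Definition dotm m n (A B : 'M[C]_(m, n)) : R := Re (\tr (A^t* *m B)).
Definition fro m n (A : 'M[C]_(m, n)) : R := dotm A A.

Lemma dotmC m n (A B : 'M[C]_(m, n)) : dotm A B = dotm B A.
Proof.
rewrite /dotm -(Re_conjC (\tr (B^t* *m A))); congr Re.
rewrite -[Num.conj_op _]trace_map_mx -[in RHS]mxtrace_tr map_trmx.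
by rewrite trmxC_mul trmxCK.
Qed.

Lemma dotmDl m n (A B D : 'M[C]_(m, n)) : dotm (A + B) D = dotm A D + dotm B D.
Proof. by rewrite /dotm trmxC_add mulmxDl mxtraceD ReD. Qed.

Lemma dotmDr m n (A B D : 'M[C]_(m, n)) : dotm D (A + B) = dotm D A + dotm D B.
Proof. by rewrite !(dotmC D) dotmDl. Qed.

Lemma dotmNl m n (A D : 'M[C]_(m, n)) : dotm (- A) D = - dotm A D.
Proof. by rewrite /dotm trmxC_opp mulNmx raddfN /= ReN. Qed.

Lemma dotmNr m n (A D : 'M[C]_(m, n)) : dotm D (- A) = - dotm D A.
Proof. by rewrite dotmC dotmNl dotmC. Qed.

Definition dotmE := (dotmDl, dotmDr, dotmNl, dotmNr).

Lemma dotm_adj m n p (A : 'M[C]_(m, n)) (B : 'M[C]_(n, p)) (D : 'M[C]_(m, p)) :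
  dotm (A *m B) D = dotm B (A^t* *m D).
Proof. by rewrite /dotm trmxC_mul mulmxA. Qed.

Lemma dotm_adjr m n p (A : 'M[C]_(m, n)) (B : 'M[C]_(n, p)) (D : 'M[C]_(m, p)) :
  dotm (A *m B) D = dotm A (D *m B^t*).
Proof. by rewrite /dotm trmxC_mul -mulmxA mxtrace_mulC mulmxA. Qed.

Lemma fro_sumE m n (A : 'M[C]_(m, n)) :
  fro A = \sum_j \sum_k (Re (A k j) ^+ 2 + complex.Im (A k j) ^+ 2).
Proof.
rewrite /fro /dotm /mxtrace Re_sum; apply: eq_bigr => j _.
rewrite mxE Re_sum; apply: eq_bigr => k _; rewrite !mxE; exact: Re_normsq.
Qed.

Lemma fro_ge0 m n (A : 'M[C]_(m, n)) : 0 <= fro A.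
Proof.
by rewrite fro_sumE; do 2!apply: sumr_ge0 => ? _; rewrite addr_ge0 // sqr_ge0.
Qed.

Lemma fro_eq0 m n (A : 'M[C]_(m, n)) : fro A = 0 -> A = 0.
Proof.
have sq (x : C) : 0 <= Re x ^+ 2 + complex.Im x ^+ 2 by rewrite addr_ge0 // sqr_ge0.
move=> /eqP; rewrite fro_sumE psumr_eq0 => [/allP A0|j _]; last exact: sumr_ge0.
apply/matrixP => k j; have := A0 j; rewrite mem_index_enum => /(_ isT) /=.
rewrite psumr_eq0 // => /allP/(_ k); rewrite mem_index_enum => /(_ isT) /=.
rewrite paddr_eq0 ?sqr_ge0 // !sqrf_eq0 mxE.
by case: (A k j) => a b /= /andP[/eqP -> /eqP ->].
Qed.

Lemma fro0 m n : fro (0 : 'M[C]_(m, n)) = 0.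
Proof. by rewrite /fro /dotm mulmx0 raddf0. Qed.

Lemma froN m n (A : 'M[C]_(m, n)) : fro (- A) = fro A.
Proof. by rewrite /fro !dotmE opprK. Qed.

Lemma fro_trmxC m n (A : 'M[C]_(m, n)) : fro (A^t*) = fro A.
Proof. by rewrite /fro /dotm trmxCK mxtrace_mulC. Qed.

Lemma froD_le m n (A B : 'M[C]_(m, n)) : fro (A + B) <= 2 * (fro A + fro B).
Proof. have := fro_ge0 (A - B); rewrite /fro !dotmE (dotmC B A); lra. Qed.

Lemma froBE m n (A B : 'M[C]_(m, n)) : fro (A - B) = fro A + fro B - 2 * dotm A B.
Proof. rewrite /fro !dotmE (dotmC B A); lra. Qed.

Lemma dotm_le m n (A B : 'M[C]_(m, n)) : 2 * dotm A B <= fro A + fro B.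
Proof. have := fro_ge0 (A - B); rewrite /fro !dotmE (dotmC B A); lra. Qed.

(** Expansion of the square of A - 2 B. The weight 1/4 lets the first term be absorbed when the
    overlap of two isometries is estimated. *)
Lemma dotm_le4 m n (A B : 'M[C]_(m, n)) : dotm A B <= fro A / 4 + fro B.
Proof.
have := fro_ge0 (A - (B + B)); rewrite /fro !dotmE (dotmC B A); lra.
Qed.

Lemma fro_isol m n p (U : 'M[C]_(m, n)) (A : 'M[C]_(n, p)) :
  U^t* *m U = 1%:M -> fro (U *m A) = fro A.
Proof. by move=> U1; rewrite /fro dotm_adj mulmxA U1 mul1mx. Qed.

Lemma fro_isor m n p (A : 'M[C]_(m, n)) (U : 'M[C]_(n, p)) :
  U *m U^t* = 1%:M -> fro (A *m U) = fro A.
Proof. by move=> U1; rewrite /fro dotm_adjr -mulmxA U1 mulmx1. Qed.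

(** Pythagoras for the range of [U] and its orthogonal complement. *)
Lemma fro_projl m n p (U : 'M[C]_(m, n)) (A : 'M[C]_(m, p)) :
  U^t* *m U = 1%:M ->
  fro A = fro (U^t* *m A) + fro ((1%:M - U *m U^t*) *m A).
Proof.
move=> U1; set Q := 1%:M - _; have QQ : Q *m Q = Q.
  by rewrite /Q mulmxBl mul1mx mulmxBr mulmx1 mulmxA -(mulmxA U) U1 mulmx1 subrr subr0.
have Qt : Q^t* = Q by rewrite /Q trmxC_sub trmxC1 trmxC_mul trmxCK.
rewrite /fro !dotm_adj trmxCK Qt [in X in _ + X]mulmxA QQ -dotmDr.
by rewrite /Q mulmxBl mul1mx mulmxA addrC subrK.
Qed.

Lemma fro_coisol m n p (U : 'M[C]_(m, n)) (A : 'M[C]_(m, p)) :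
  U^t* *m U = 1%:M -> fro (U^t* *m A) <= fro A.
Proof. by move=> U1; rewrite (fro_projl A U1) lerDl fro_ge0. Qed.

Lemma fro_iso m n (U : 'M[C]_(m, n)) : U^t* *m U = 1%:M -> fro U = n%:R.
Proof. by move=> U1; rewrite /fro /dotm U1 mxtrace1 Re_nat. Qed.

Lemma unitary_adj n (U : 'M[C]_n) :
  U \is unitarymx -> U *m U^t* = 1%:M /\ U^t* *m U = 1%:M.
Proof. by move=> /unitarymxP UU; split=> //; exact: mulmx1C. Qed.

Lemma hs_norm_cvg (d : nat -> nat) (A : forall n, 'M[C]_(d n)) :
  hs_norm (A n) @[n --> \oo] --> (0 : R) <->
  fro (A n) / (d n)%:R @[n --> \oo] --> (0 : R).
Proof.
have E n : hs_norm (A n) = Num.sqrt (fro (A n) / (d n)%:R).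
  by rewrite /hs_norm /normalized_trace Re_natr_div.
split=> A0.
  have -> : (fun n => fro (A n) / (d n)%:R) = (fun n => hs_norm (A n) * hs_norm (A n)).
    by apply/funext => n; rewrite E -expr2 sqr_sqrtr // divr_ge0 ?fro_ge0.
  by rewrite -[X in _ --> X](mulr0 0); exact: cvgM.
have -> : (fun n => hs_norm (A n)) = (fun n => Num.sqrt (fro (A n) / (d n)%:R)).
  by apply/funext => n; rewrite E.
have := continuous_cvg _ (@sqrt_continuous R 0) A0; rewrite sqrtr0; exact.
Qed.

End Frobenius.

(** * Multiplicities of unitary representations *)

Section Isometries.
Context (R : realType).
Local Notation C := R[i].

(** [I] is an orthonormal basis of the column space. Gram-Schmidt works on rows, hence the passage
    through the adjoint. *)
Lemma colspan_isometry n k (M : 'M[C]_(n, k)) : exists l (I : 'M[C]_(n, l)),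
  [/\ I^t* *m I = 1%:M, exists E, M = I *m E & exists F, I = M *m F].
Proof.
pose B := schmidt (row_base (M^t*)).
have BB : B *m B^t* = 1%:M.
  by apply/unitarymxP; apply: schmidt_unitarymx; exact: rank_leq_col.
have BM : (B :=: (M^t*))%MS.
  by apply: eqmx_trans (eq_row_base _); apply: eqmx_schmidt_free; exact: row_base_free.
exists _, (B^t*); split; first by rewrite trmxCK.
  have /submxP[D MD] : (M^t* <= B)%MS by rewrite BM.
  by exists (D^t*); rewrite -trmxC_mul -MD trmxCK.
have /submxP[D ->] : (B <= M^t*)%MS by rewrite BM.
by exists (D^t*); rewrite trmxC_mul trmxCK.
Qed.

Lemma projection_isometry n (Q : 'M[C]_n) : Q^t* = Q -> Q *m Q = Q ->
  exists k (I : 'M[C]_(n, k)), I^t* *m I = 1%:M /\ I *m I^t* = Q.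
Proof.
move=> Qt QQ; have [k [I [I1 [E QE] [F IF]]]] := colspan_isometry Q.
exists k, I; split=> //.
have PQ : I *m I^t* *m Q = Q by rewrite QE mulmxA -(mulmxA I) I1 mulmx1.
have QI : Q *m I = I by rewrite IF mulmxA QQ.
(* The adjoint reads Q I I^* = Q, and the left side is I I^* because Q I = I. *)
have : (I *m I^t* *m Q)^t* = Q by rewrite PQ.
by rewrite !trmxC_mul trmxCK Qt mulmxA QI.
Qed.

Lemma complement_isometry n k (I : 'M[C]_(n, k)) : I^t* *m I = 1%:M ->
  exists l (J : 'M[C]_(n, l)), J^t* *m J = 1%:M /\ I *m I^t* + J *m J^t* = 1%:M.
Proof.
move=> I1; have [||l [J [J1 JE]]] := @projection_isometry n (1%:M - I *m I^t*).
- by rewrite trmxC_sub trmxC1 trmxC_mul trmxCK.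
- by rewrite mulmxBl mul1mx mulmxBr mulmx1 mulmxA -(mulmxA I) I1 mulmx1 subrr subr0.
by exists l, J; rewrite JE addrC subrK.
Qed.

Lemma isometry_mul n k l (A : 'M[C]_(n, k)) (B : 'M[C]_(k, l)) :
  A^t* *m A = 1%:M -> B^t* *m B = 1%:M -> (A *m B)^t* *m (A *m B) = 1%:M.
Proof.
by move=> A1 B1; rewrite trmxC_mul mulmxA -(mulmxA _ _ A) A1 mulmx1.
Qed.

(** Comparison of traces. *)
Lemma isometry_dim n k l (I : 'M[C]_(n, k)) (J : 'M[C]_(n, l)) :
  I^t* *m I = 1%:M -> J^t* *m J = 1%:M -> I *m I^t* + J *m J^t* = 1%:M ->
  n = (k + l)%N.
Proof.
move=> I1 J1 IJ; apply/eqP; rewrite -(eqr_nat R) natrD -!Re_nat -!(mxtrace1 C).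
by rewrite -IJ -I1 -J1 mxtraceD ReD mxtrace_mulC (mxtrace_mulC J).
Qed.

End Isometries.

Section Reps.
Context (R : realType) (H : groupType).
Local Notation C := R[i].

Definition intertwines m n (a : H -> 'M[C]_m) (b : H -> 'M[C]_n) (A : 'M[C]_(n, m)) :=
  forall h, b h *m A = A *m a h.

Lemma rep_unitary n (a : H -> 'M[C]_n) h : is_unitary_rep a ->
  a h *m (a h)^t* = 1%:M /\ (a h)^t* *m a h = 1%:M.
Proof. by move=> [aU _]; exact: unitary_adj. Qed.

Lemma rep1 n (a : H -> 'M[C]_n) : is_unitary_rep a -> a 1%g = 1%:M.
Proof.
move=> aP; have [_ aM] := aP; have [_ a1] := rep_unitary 1%g aP.
by rewrite -[LHS]mul1mx -a1 -mulmxA -aM mulg1.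
Qed.

Lemma repV n (a : H -> 'M[C]_n) h : is_unitary_rep a -> a (h^-1)%g = (a h)^t*.
Proof.
move=> aP; have [_ aM] := aP; have [ah _] := rep_unitary h aP.
by rewrite -[LHS]mulmx1 -ah mulmxA -aM mulVg rep1 // mul1mx.
Qed.

Lemma intertwines_adj m n (a : H -> 'M[C]_m) (b : H -> 'M[C]_n) A :
  is_unitary_rep a -> is_unitary_rep b ->
  intertwines a b A -> intertwines b a (A^t*).
Proof.
move=> aP bP AE h; have /(congr1 (fun X => X^t*)) := AE (h^-1)%g.
by rewrite !trmxC_mul !repV // !trmxCK.
Qed.

Lemma intertwines_comp l m n (a : H -> 'M[C]_l) (b : H -> 'M[C]_m)
    (c : H -> 'M[C]_n) A B :
  intertwines a b A -> intertwines b c B -> intertwines a c (B *m A).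
Proof. by move=> AE BE h; rewrite mulmxA BE -mulmxA AE mulmxA. Qed.

Lemma subrep n k (a : H -> 'M[C]_n) (I : 'M[C]_(n, k)) :
  is_unitary_rep a -> I^t* *m I = 1%:M -> intertwines a a (I *m I^t*) ->
  is_unitary_rep (fun h => I^t* *m a h *m I) /\
  intertwines (fun h => I^t* *m a h *m I) a I.
Proof.
move=> aP I1 IE.
have E : intertwines (fun h => I^t* *m a h *m I) a I.
  by move=> h; rewrite !mulmxA -IE -mulmxA -(mulmxA I) I1 mulmx1.
split=> //; have [_ aM] := aP; split=> [h|g h].
  have aI : I *m (I^t* *m (a h *m I)) = a h *m I by rewrite [RHS]E !mulmxA.
  apply/unitarymxP/mulmx1C; rewrite !trmxC_mul trmxCK -!mulmxA aI.
  by have [_ ah] := rep_unitary h aP; rewrite (mulmxA _ (a h)) ah mul1mx.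
by rewrite -[RHS]mulmxA -E aM !mulmxA.
Qed.

Lemma complement_rep n k (a : H -> 'M[C]_n) (b : H -> 'M[C]_k) (I : 'M[C]_(n, k)) :
  is_unitary_rep a -> is_unitary_rep b -> I^t* *m I = 1%:M -> intertwines b a I ->
  exists l (c : H -> 'M[C]_l) (J : 'M[C]_(n, l)),
  [/\ is_unitary_rep c, J^t* *m J = 1%:M, intertwines c a J
    & I *m I^t* + J *m J^t* = 1%:M].
Proof.
move=> aP bP I1 IE; have [l [J [J1 JE]]] := complement_isometry I1.
have Qa : intertwines a a (J *m J^t*).
  have -> : J *m J^t* = 1%:M - I *m I^t* by rewrite -JE addrC addKr.
  move=> h; have := intertwines_comp (intertwines_adj bP aP IE) IE h.
  by rewrite mulmxBl mulmxBr mul1mx mulmx1 => ->.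
have [cP cE] := subrep aP J1 Qa.
by exists l, (fun h => J^t* *m a h *m J), J.
Qed.

(** If Q projects onto an invariant subspace, then Q a Q = a Q for every group element; the adjoint
    of this identity at the inverse is Q a Q = Q a, so Q commutes with the representation and the
    orthogonal complement is invariant too. *)
Lemma reducible_split n (a : H -> 'M[C]_n) : is_unitary_rep a -> (0 < n)%N ->
  ~ is_irreducible_rep a ->
  exists k l (b : H -> 'M[C]_k) (c : H -> 'M[C]_l) (I : 'M[C]_(n, k)) (J : 'M[C]_(n, l)),
  [/\ [/\ (k < n)%N, (l < n)%N, is_unitary_rep b & is_unitary_rep c],
      [/\ I^t* *m I = 1%:M, J^t* *m J = 1%:M & I *m I^t* + J *m J^t* = 1%:M]
    & intertwines b a I /\ intertwines c a J].
Proof.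
move=> aP n0 nirr.
have [W [WS W0 Wf]] : exists W : {vspace 'cV[C]_n},
    [/\ forall h (v : 'cV[C]_n), v \in W -> a h *m v \in W, W <> 0%VS & W <> fullv].
  apply: contrapT => nW; apply: nirr; split=> // W WS.
  by apply: contrapT => /not_orP[? ?]; apply: nW; exists W.
pose M : 'M[C]_(n, \dim W) := \matrix_(p, q) (vbasis W)`_q p 0.
have ME (x : 'cV_(\dim W)) : M *m x = \sum_q x q 0 *: (vbasis W)`_q.
  apply/matrixP => p q; rewrite ord1 summxE mxE; apply: eq_bigr => j _.
  by rewrite !mxE mulrC.
have MW x : M *m x \in W.
  rewrite ME; apply: memv_suml => q _; apply: memvZ; apply: vbasis_mem.
  by rewrite mem_nth // size_tuple.
have WM v : v \in W -> exists x, v = M *m x.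
  move=> vW; exists (\col_q coord (vbasis W) q v); rewrite ME {1}(coord_vbasis vW).
  by apply: eq_bigr => q _; rewrite mxE.
have [k [I [I1 [E MIE] [F IMF]]]] := colspan_isometry M.
have IW (x : 'cV_k) : I *m x \in W by rewrite IMF -mulmxA MW.
have WI v : v \in W -> I *m I^t* *m v = v.
  by move=> /WM[x ->]; rewrite MIE !mulmxA -(mulmxA I) I1 mulmx1.
have aI h : I *m I^t* *m (a h *m I) = a h *m I.
  apply: trmx_inj; apply/row_matrixP => q; rewrite -!tr_col !colE.
  by rewrite -mulmxA WI // -mulmxA WS // IW.
have QE : intertwines a a (I *m I^t*).
  have aQ h : I *m I^t* *m a h *m (I *m I^t*) = a h *m (I *m I^t*).
    by have := congr1 (mulmx^~ (I^t*)) (aI h); rewrite -!mulmxA.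
  move=> h; rewrite -[LHS]aQ; have /(congr1 (fun X => X^t*)) := aQ (h^-1)%g.
  by rewrite !trmxC_mul !repV // !trmxCK !mulmxA.
have [bP bE] := subrep aP I1 QE.
have [l [c [J [cP J1 cE IJ]]]] := complement_rep aP bP I1 bE.
have nkl := isometry_dim I1 J1 IJ.
exists k, l, (fun h => I^t* *m a h *m I), c, I, J; split; [split=> //|by []|by split].
- rewrite nkl -[X in (X < _)%N]addn0 ltn_add2l lt0n; apply/eqP => l0.
  apply: Wf; apply/vspaceP => v; rewrite memvf; subst l.
  have {1}-> : v = I *m I^t* *m v.
    by rewrite -{1}(mul1mx v) -IJ [J]thinmx0 mul0mx addr0.
  by rewrite -mulmxA IW.
- rewrite nkl -[X in (X < _)%N]add0n ltn_add2r lt0n; apply/eqP => k0.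
  subst k; apply: W0; apply/eqP; rewrite -subv0; apply/subvP => v /WM[x ->].
  by rewrite MIE [I]thinmx0 !mul0mx mem0v.
Qed.

Context (r : nat) (T : 'I_r -> irr_unitary_rep R H).
Hypothesis TP : forall t : irr_unitary_rep R H, exists j, rep_iso t (T j).

(** An orthogonal decomposition, indexed by the type and the number of the copy. Orthogonality of
    distinct summands follows from the last clause, by [split_orthogonal]. *)
Definition has_reps n (a : H -> 'M[C]_n) (m : 'I_r -> nat) :=
  exists I : forall p : {j : 'I_r & 'I_(m j)}, 'M[C]_(n, rep_dim (T (tag p))),
  [/\ forall p, intertwines (@rep_mx _ _ (T (tag p))) a (I p),
      forall p, (I p)^t* *m I p = 1%:M
    & \sum_p I p *m (I p)^t* = 1%:M].

Lemma fro_splitl n k (P : finType) (d : P -> nat) (I : forall p, 'M[C]_(n, d p))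
    (X : 'M[C]_(n, k)) :
  \sum_p I p *m (I p)^t* = 1%:M -> fro X = \sum_p fro ((I p)^t* *m X).
Proof.
move=> I1; rewrite {1}/fro -{1}(mul1mx X) -I1 mulmx_suml.
rewrite /dotm trmxC_sum mulmx_suml [\tr _]raddf_sum Re_sum; apply: eq_bigr => p _.
by rewrite /fro /dotm !trmxC_mul trmxCK !mulmxA.
Qed.

Lemma fro_splitr n k (P : finType) (d : P -> nat) (I : forall p, 'M[C]_(n, d p))
    (X : 'M[C]_(k, n)) :
  \sum_p I p *m (I p)^t* = 1%:M -> fro X = \sum_p fro (X *m I p).
Proof.
move=> I1; rewrite -fro_trmxC (fro_splitl _ I1); apply: eq_bigr => p _.
by rewrite -trmxC_mul fro_trmxC.
Qed.

Lemma split_mul k n (P : finType) (d : P -> nat) (A : 'M[C]_(k, n))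
    (I : forall p, 'M[C]_(n, d p)) :
  \sum_p I p *m (I p)^t* = 1%:M ->
  A *m A^t* = \sum_p (A *m I p) *m (A *m I p)^t*.
Proof.
move=> I1; rewrite -{1}(mulmx1 A) -I1 mulmx_sumr mulmx_suml.
by apply: eq_bigr => p _; rewrite trmxC_mul !mulmxA.
Qed.

(** The squared norm of [I q] is the sum over p of those of its components along the [I p], and the
    component along [I q] already accounts for all of it. *)
Lemma split_orthogonal n (P : finType) (d : P -> nat)
    (I : forall p, 'M[C]_(n, d p)) p q :
  (forall p, (I p)^t* *m I p = 1%:M) -> \sum_p I p *m (I p)^t* = 1%:M ->
  p != q -> (I p)^t* *m I q = 0.
Proof.
move=> Ip I1 pq; have := fro_splitl (I q) I1.
rewrite (bigD1 q) //= Ip !fro_iso ?trmxC1 ?mul1mx // -[LHS]addr0 => /addrI/esym/eqP.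
rewrite psumr_eq0 => [/allP/(_ p)|k _]; last exact: fro_ge0.
by rewrite mem_index_enum pq => /(_ isT)/= /eqP/fro_eq0.
Qed.

Lemma has_reps_iso n1 n2 (a1 : H -> 'M[C]_n1) (a2 : H -> 'M[C]_n2) m :
  is_unitary_rep a1 -> has_reps a1 m -> has_reps a2 m ->
  exists V : 'M[C]_(n2, n1),
    [/\ V *m V^t* = 1%:M, V^t* *m V = 1%:M & intertwines a1 a2 V].
Proof.
move=> a1P [I1 [I1E I1I I1S]] [I2 [I2E I2I I2S]].
exists (\sum_p I2 p *m (I1 p)^t*); split.
- rewrite trmxC_sum mulmx_suml -[RHS]I2S; apply: eq_bigr => p _.
  rewrite mulmx_sumr (bigD1 p) //= big1 => [|q qp].
    by rewrite addr0 trmxC_mul trmxCK mulmxA -(mulmxA _ _ (I1 p)) I1I mulmx1.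
  rewrite trmxC_mul trmxCK mulmxA -(mulmxA _ _ (I1 q)).
  by rewrite (split_orthogonal I1I I1S) 1?eq_sym // mulmx0 mul0mx.
- rewrite trmxC_sum mulmx_suml -[RHS]I1S; apply: eq_bigr => p _.
  rewrite mulmx_sumr (bigD1 p) //= big1 => [|q qp].
    by rewrite addr0 trmxC_mul trmxCK mulmxA -(mulmxA _ _ (I2 p)) I2I mulmx1.
  rewrite trmxC_mul trmxCK mulmxA -(mulmxA _ _ (I2 q)).
  by rewrite (split_orthogonal I2I I2S) 1?eq_sym // mulmx0 mul0mx.
move=> h; rewrite mulmx_sumr mulmx_suml; apply: eq_bigr => p _.
by rewrite mulmxA I2E -!mulmxA (intertwines_adj (rep_mxP _) a1P (I1E p)).
Qed.

Lemma has_repsD n n1 n2 (a : H -> 'M[C]_n) (a1 : H -> 'M[C]_n1)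
    (a2 : H -> 'M[C]_n2) (A1 : 'M[C]_(n, n1)) (A2 : 'M[C]_(n, n2)) m1 m2 :
  A1^t* *m A1 = 1%:M -> A2^t* *m A2 = 1%:M ->
  A1 *m A1^t* + A2 *m A2^t* = 1%:M ->
  intertwines a1 a A1 -> intertwines a2 a A2 ->
  has_reps a1 m1 -> has_reps a2 m2 -> has_reps a (fun j => m1 j + m2 j)%N.
Proof.
move=> A1I A2I AS A1E A2E [I1 [I1E I1I I1S]] [I2 [I2E I2I I2S]].
pose I (p : {j : 'I_r & 'I_(m1 j + m2 j)}) : 'M[C]_(n, rep_dim (T (tag p))) :=
  match fintype.split (tagged p) with
  | inl k => A1 *m I1 (Tagged (fun j => 'I_(m1 j)) k)
  | inr k => A2 *m I2 (Tagged (fun j => 'I_(m2 j)) k) end.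
exists I; split.
- move=> [j k]; rewrite /I /=; case: (fintype.split k) => l.
    exact: intertwines_comp (I1E (Tagged _ l)) A1E.
  exact: intertwines_comp (I2E (Tagged _ l)) A2E.
- move=> [j k]; rewrite /I /=; case: (fintype.split k) => l.
    exact: isometry_mul A1I (I1I (Tagged _ l)).
  exact: isometry_mul A2I (I2I (Tagged _ l)).
have -> : \sum_p I p *m (I p)^t* = \sum_j \sum_(k < m1 j + m2 j)
    I (Tagged (fun j => 'I_(m1 j + m2 j)) k) *m
    (I (Tagged (fun j => 'I_(m1 j + m2 j)) k))^t*.
  by rewrite sig_big_dep; apply: eq_bigr => -[].
rewrite -AS.
have -> : A1 *m A1^t* = \sum_j \sum_(k < m1 j)
    A1 *m I1 (Tagged _ k) *m (A1 *m I1 (Tagged _ k))^t*.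
  by rewrite (split_mul A1 I1S) sig_big_dep; apply: eq_bigr => -[].
have -> : A2 *m A2^t* = \sum_j \sum_(k < m2 j)
    A2 *m I2 (Tagged _ k) *m (A2 *m I2 (Tagged _ k))^t*.
  by rewrite (split_mul A2 I2S) sig_big_dep; apply: eq_bigr => -[].
rewrite -big_split /=.
apply: eq_bigr => j _; rewrite big_split_ord /=; congr (_ + _); apply: eq_bigr => k _.
  by rewrite /I /= (unsplitK (inl k)).
by rewrite /I /= (unsplitK (inr k)).
Qed.

Lemma has_reps0 (a : H -> 'M[C]_0) : has_reps a (fun=> 0%N).
Proof.
have n0 (p : {j : 'I_r & 'I_0}) : False by case: p => j [].
exists (fun p => 0); split=> [p|p|]; [case: (n0 p)|case: (n0 p)|].
by apply/matrixP => -[].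
Qed.

Lemma has_reps_irr n (a : H -> 'M[C]_n) :
  is_unitary_rep a -> is_irreducible_rep a ->
  exists j, has_reps a (fun k => (k == j)%N).
Proof.
move=> aP airr; have [j [U [U1 U2 UE]]] := TP (IrrUnitaryRep aP airr).
rewrite /= in U U1 U2 UE; exists j.
have UaE : intertwines (@rep_mx _ _ (T j)) a (U^t*).
  by apply: (intertwines_adj aP (rep_mxP _)) => h; rewrite UE.
(* There is a single index, with tag [j], but the type of [I p] depends on the tag, hence the
   transport; the value 0 is a dummy. *)
pose I (p : {k : 'I_r & 'I_(k == j)%N}) : 'M[C]_(n, rep_dim (T (tag p))) :=
  match tag p =P j with
  | ReflectT e => eq_rect_r (fun k => 'M[C]_(n, rep_dim (T k))) (U^t*) e
  | ReflectF _ => 0 end.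
have p0 : 'I_(j == j)%N by rewrite eqxx; exact: ord0.
have pE (p : {k : 'I_r & 'I_(k == j)%N}) : p = Tagged (fun k => 'I_(k == j)%N) p0.
  case: p => k l; have kj : k = j.
    by apply: contrapT => /eqP/negPf kj; case: l => l /=; rewrite kj.
  subst k; suff -> : l = p0 by [].
  apply: val_inj; case: l p0 => l + [l' +] /=; rewrite eqxx.
  by case: l l' => [|l] [|l'].
have I0 : I (Tagged (fun k => 'I_(k == j)%N) p0) = U^t*.
  by rewrite /I /=; case: eqP => // e; rewrite (eq_irrelevance e erefl).
exists I; split.
- by move=> p; rewrite (pE p) I0.
- by move=> p; rewrite (pE p) I0 trmxCK U2.
rewrite (bigD1 (Tagged (fun k => 'I_(k == j)%N) p0)) //= I0 trmxCK U1 big1 ?addr0 //.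
by move=> p /eqP []; exact: pE.
Qed.

Lemma has_reps_exists n (a : H -> 'M[C]_n) :
  is_unitary_rep a -> exists m, has_reps a m.
Proof.
have [N] := ubnP n; elim: N => // N IHN in n a *; rewrite ltnS => nN aP.
have [n0|n0] := posnP n; first by subst n; exists (fun=> 0%N); exact: has_reps0.
have [airr|nirr] := pselect (is_irreducible_rep a).
  by have [j aj] := has_reps_irr aP airr; exists (fun k => (k == j)%N).
have [k [l [b [c [I [J [[kn ln bP cP] [I1 J1 IJ] [bE cE]]]]]]]] :=
  reducible_split aP n0 nirr.
have [m bm] := IHN _ b (leq_trans kn nN) bP.
have [m' cm] := IHN _ c (leq_trans ln nN) cP.
by exists (fun j => m j + m' j)%N; exact: has_repsD I1 J1 IJ bE cE bm cm.
Qed.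

(** Each summand contributes to [n] its dimension, which is at least 1. *)
Lemma has_reps_dim n (a : H -> 'M[C]_n) m : has_reps a m -> (\sum_j m j <= n)%N.
Proof.
move=> [I [_ I1 IS]]; rewrite -(ler_nat R).
have -> : (n%:R : R) = \sum_(p : {j : 'I_r & 'I_(m j)}) fro (I p).
  rewrite -(@fro_iso R n n 1%:M) ?trmxC1 ?mulmx1 // (fro_splitr _ IS).
  by apply: eq_bigr => p _; rewrite mul1mx.
have -> : (\sum_j m j)%N = \sum_(p : {j : 'I_r & 'I_(m j)}) 1%N.
  transitivity (\sum_j \sum_(k < m j) 1)%N; last by rewrite sig_big_dep.
  by apply: eq_bigr => j _; rewrite sum1_card card_ord.
rewrite natr_sum; apply: ler_sum => p _; rewrite fro_iso // ler_nat.
by have [] := rep_irr (T (tag p)).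
Qed.

End Reps.

(** * Almost intertwiners *)

Section Gap.
Context (R : realType).
Local Notation C := R[i].

Lemma fro_sum_le (I : Type) (s : seq I) m n (F : I -> 'M[C]_(m, n)) :
  fro (\sum_(k <- s) F k) <= 2 ^+ size s * \sum_(k <- s) fro (F k).
Proof.
elim: s => [|k s IHs]; first by rewrite !big_nil fro0 mulr0.
rewrite !big_cons /= exprS -mulrA; apply: le_trans (froD_le _ _) _.
have := fro_ge0 (F k); set x := fro (F k) => x0.
have : (1 : R) <= 2 ^+ size s by rewrite exprn_ege1 // ler1n.
by set y := 2 ^+ _ => y1; rewrite ler_pM2l ?ltr0n // mulrDr lerD // ler_peMl.
Qed.

Lemma froZ (c : C) m n (A : 'M[C]_(m, n)) :
  fro (c *: A) = (complex.Re c ^+ 2 + complex.Im c ^+ 2) * fro A.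
Proof.
rewrite !fro_sumE mulr_sumr; apply: eq_bigr => j _; rewrite mulr_sumr.
apply: eq_bigr => k _; rewrite mxE; case: (A k j) => x y; case: c => a b /=; ring.
Qed.

Lemma fro_mulr_le m n (L : 'M[C]_(m, n)) :
  exists2 K, 0 <= K & forall v : 'rV[C]_m, fro (v *m L) <= K * fro v.
Proof.
exists (2 ^+ size (index_enum 'I_m) * \sum_k fro (row k L)) => [|v].
  by rewrite mulr_ge0 ?exprn_ge0 // sumr_ge0 // => k _; exact: fro_ge0.
rewrite mulmx_sum_row; apply: le_trans (fro_sum_le _ _) _.
rewrite -mulrA ler_pM2l ?exprn_gt0 ?ltr0n // mulrC fro_sumE mulr_suml.
apply: ler_sum => k _; rewrite froZ big_ord1; apply: ler_wpM2l.
  by rewrite addr_ge0 // sqr_ge0.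
rewrite (bigD1 k) //= lerDl; apply: sumr_ge0 => j _; exact: fro_ge0.
Qed.

Lemma fro_row_mx m n1 n2 (A : 'M[C]_(m, n1)) (B : 'M[C]_(m, n2)) :
  fro (row_mx A B) = fro A + fro B.
Proof.
rewrite !fro_sumE big_split_ord; congr (_ + _); apply: eq_bigr => j _;
  by apply: eq_bigr => k _; rewrite ?row_mxEl ?row_mxEr.
Qed.

Lemma fro_mxvec m n (A : 'M[C]_(m, n)) : fro (mxvec A) = fro A.
Proof.
rewrite !fro_sumE (reindex _ (curry_mxvec_bij m n)) /=.
rewrite [RHS]exchange_big [RHS]pair_bigA /=; apply: eq_bigr => -[k j] _.
by rewrite big_ord1 mxvecE.
Qed.

(** A linear map is bounded below modulo its kernel. The maps are joined into one matrix [D], and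
    the generalized inverse of [D] moves [x] into the kernel by a vector bounded in terms of x D. *)
Lemma row_gap m n (I : eqType) (s : seq I) (B : I -> 'M[C]_(m, n)) :
  exists2 K, 0 <= K & forall x : 'rV[C]_m, exists y : 'rV[C]_m,
    (forall k, k \in s -> y *m B k = 0) /\
    fro (x - y) <= K * \sum_(k <- s) fro (x *m B k).
Proof.
have [c [D [D0 Dfro]]] : exists c (D : 'M[C]_(m, c)),
    (forall y : 'rV_m, y *m D = 0 -> forall k, k \in s -> y *m B k = 0) /\
    (forall x : 'rV_m, fro (x *m D) = \sum_(k <- s) fro (x *m B k)).
  elim: s => [|k s [c [D [D0 Dfro]]]].
    exists 0%N, 0; split=> // x; rewrite big_nil mulmx0; exact: fro0.
  exists (n + c)%N, (row_mx (B k) D); split=> x; rewrite mul_mx_row.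
    rewrite -row_mx0 => /eq_row_mx[x1 /D0 x2] l.
    by rewrite inE => /orP[/eqP ->|/x2].
  by rewrite fro_row_mx Dfro big_cons.
have [K K0 KP] := fro_mulr_le (pinvmx D); exists K => // x.
exists (x - x *m D *m pinvmx D); split.
  apply: D0; rewrite mulmxBl mulmxKpV ?subrr //; exact: submxMl.
by rewrite opprB addrC subrK -Dfro; exact: KP.
Qed.

(** Intertwining is a linear system in the entries of [X], so [row_gap] applies after
    vectorization. *)
Lemma pair_gap m n (I : eqType) (s : seq I) (a : I -> 'M[C]_m) (b : I -> 'M[C]_n) :
  exists2 K, 0 <= K & forall X : 'M[C]_(n, m), exists Y : 'M[C]_(n, m),
    (forall k, k \in s -> b k *m Y = Y *m a k) /\
    fro (X - Y) <= K * \sum_(k <- s) fro (b k *m X - X *m a k).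
Proof.
pose B k := lin_mulmx (b k) - lin_mulmxr (a k) : 'M[C]_(n * m).
have BE k X : mxvec X *m B k = mxvec (b k *m X - X *m a k).
  by rewrite mulmxBr !mul_vec_lin linearB.
have [K K0 KP] := row_gap s B; exists K => // X; have [y [y0 yX]] := KP (mxvec X).
exists (vec_mx y); split=> [k /y0|].
  rewrite -{1}(vec_mxK y) BE => /(canRL mxvecK); rewrite linear0.
  by move/eqP; rewrite subr_eq0 => /eqP.
rewrite -fro_mxvec linearB /= vec_mxK; apply: le_trans yX _.
by rewrite le_eqVlt; apply/orP; left; apply/eqP; congr (_ * _);
  apply: eq_bigr => k _; rewrite BE fro_mxvec.
Qed.

End Gap.

Section UniformGap.
Context (R : realType) (H : groupType).
Local Notation C := R[i].

Lemma intertwines_gen (s : seq H) m n (a : H -> 'M[C]_m) (b : H -> 'M[C]_n) A :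
  smallest (@is_subgroup H) [set` s] = setT ->
  is_unitary_rep a -> is_unitary_rep b ->
  (forall h, h \in s -> b h *m A = A *m a h) -> intertwines a b A.
Proof.
move=> sT aP bP As h; have [_ aM] := aP; have [_ bM] := bP.
have : smallest (@is_subgroup H) [set` s] h by rewrite sT.
move=> /(_ [set k | b k *m A = A *m a k]); apply; split; last exact: As.
split=> /= [|k l kA lA|k kA].
- by rewrite !rep1 // mulmx1 mul1mx.
- by rewrite aM bM -mulmxA lA mulmxA kA mulmxA.
rewrite !repV //; have [_ b1] := rep_unitary k bP; have [a1 _] := rep_unitary k aP.
by rewrite -[LHS]mulmx1 -a1 mulmxA -(mulmxA _ A) -kA mulmxA b1 mul1mx.
Qed.

Context (r : nat) (T : 'I_r -> irr_unitary_rep R H).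
Hypothesis TP : forall t : irr_unitary_rep R H, exists j, rep_iso t (T j).

(** [X] is cut into blocks between irreducible summands, and each block is corrected on its own.
    Squared norms add up over blocks and only finitely many pairs of irreducibles occur, so [K]
    depends neither on the dimensions nor on the multiplicities. Testing on generators is enough to
    get a true intertwiner. *)
Lemma uniform_gap : finitely_generated H -> exists (s : seq H) (K : R),
  0 <= K /\ forall m n (a : H -> 'M[C]_m) (b : H -> 'M[C]_n) (X : 'M[C]_(n, m)),
  is_unitary_rep a -> is_unitary_rep b ->
  exists2 Y, intertwines a b Y &
    fro (X - Y) <= K * \sum_(h <- s) fro (b h *m X - X *m a h).
Proof.
move=> [s sT].
have KP (p : 'I_r * 'I_r) : exists K, 0 <= K /\ forall X, exists Y,
    (forall h, h \in s -> rep_mx (T p.2) h *m Y = Y *m rep_mx (T p.1) h) /\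
    fro (X - Y) <= K * \sum_(h <- s) fro (rep_mx (T p.2) h *m X - X *m rep_mx (T p.1) h).
  have [K K0 KX] := pair_gap s (@rep_mx _ _ (T p.1)) (@rep_mx _ _ (T p.2)).
  by exists K; split.
have {KP} /choice[k kP] := KP.
have k0 p : 0 <= k p by have [] := kP p.
pose K := \sum_p k p; have kK p : k p <= K.
  by rewrite /K (bigD1 p) //= lerDl sumr_ge0.
have K0 : 0 <= K by apply: sumr_ge0.
exists s, K; split=> // m n a b X aP bP.
have [ma [I [IE I1 IS]]] := has_reps_exists TP aP.
have [mb [J [JE J1 JS]]] := has_reps_exists TP bP.
have Yex (pq : {j : 'I_r & 'I_(ma j)} * {j : 'I_r & 'I_(mb j)}) :
    exists Y : 'M[C]_(rep_dim (T (tag pq.2)), rep_dim (T (tag pq.1))),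
    intertwines (@rep_mx _ _ (T (tag pq.1))) (@rep_mx _ _ (T (tag pq.2))) Y /\
    fro ((J pq.2)^t* *m X *m I pq.1 - Y) <=
      K * \sum_(h <- s) fro ((J pq.2)^t* *m (b h *m X - X *m a h) *m I pq.1).
  have [_ /(_ ((J pq.2)^t* *m X *m I pq.1))[Y [Ys YX]]] := kP (tag pq.1, tag pq.2).
  exists Y; split; first by apply: (intertwines_gen sT) => //; exact: rep_mxP.
  apply: le_trans YX _ => /=.
  have -> : \sum_(h <- s) fro ((J pq.2)^t* *m (b h *m X - X *m a h) *m I pq.1) =
    \sum_(h <- s) fro (rep_mx (T (tag pq.2)) h *m ((J pq.2)^t* *m X *m I pq.1) -
      (J pq.2)^t* *m X *m I pq.1 *m rep_mx (T (tag pq.1)) h).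
    apply: eq_bigr => h _; congr fro; rewrite mulmxBr mulmxBl !mulmxA.
    rewrite (intertwines_adj (rep_mxP _) bP (JE _)) -!mulmxA; congr (_ - _).
    by rewrite IE.
  by apply: ler_wpM2r => //; apply: sumr_ge0 => h _; exact: fro_ge0.
pose Y pq := sval (cid (Yex pq)); have YP pq := svalP (cid (Yex pq)).
rewrite -/(Y _) in YP.
exists (\sum_q \sum_p J q *m Y (p, q) *m (I p)^t*).
  move=> h; rewrite mulmx_sumr mulmx_suml; apply: eq_bigr => q _.
  rewrite mulmx_sumr mulmx_suml; apply: eq_bigr => p _.
  have Yh : rep_mx (T (tag q)) h *m Y (p, q) = Y (p, q) *m rep_mx (T (tag p)) h.
    exact: (YP (p, q)).1.
  rewrite !mulmxA JE -(mulmxA (J q)) Yh -!mulmxA.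
  by rewrite (intertwines_adj (rep_mxP _) aP (IE p)).
set Z := \sum_q _.
have ZE p q : (J q)^t* *m Z *m I p = Y (p, q).
  rewrite mulmx_sumr (bigD1 q) //= [X in _ + X]big1 => [|q' q'q].
    rewrite addr0 mulmx_sumr mulmx_suml (bigD1 p) //= big1 => [|p' p'p].
      by rewrite addr0 !mulmxA J1 mul1mx -mulmxA I1 mulmx1.
    by rewrite -!mulmxA (split_orthogonal I1 IS p'p) !mulmx0.
  rewrite mulmx_sumr big1 // => p' _.
  by rewrite !mulmxA (split_orthogonal J1 JS) 1?eq_sym // !mul0mx.
rewrite (fro_splitl _ JS).
under eq_bigr => q _ do rewrite (fro_splitr _ IS).
under eq_bigr => q _ do under eq_bigr => p _ do rewrite mulmxBr mulmxBl ZE.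
have -> : \sum_(h <- s) fro (b h *m X - X *m a h) =
    \sum_q \sum_p \sum_(h <- s) fro ((J q)^t* *m (b h *m X - X *m a h) *m I p).
  under eq_bigr => h _ do rewrite (fro_splitl _ JS).
  rewrite exchange_big; apply: eq_bigr => q _.
  under eq_bigr => h _ do rewrite (fro_splitr _ IS).
  by rewrite exchange_big.
rewrite mulr_sumr; apply: ler_sum => q _; rewrite mulr_sumr; apply: ler_sum => p _.
exact: (YP (p, q)).2.
Qed.

End UniformGap.

(** * Polar decomposition of intertwiners *)

Section Polar.
Context (R : realType) (H : groupType).
Local Notation C := R[i].

(** An entry of [M] can only be nonzero between equal diagonal values, and [f] keeps them equal. *)
Lemma commuting_diag n (M : 'M[C]_n) (d : 'rV[C]_n) (f : C -> C) :
  M *m diag_mx d = diag_mx d *m M ->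
  M *m diag_mx (map_mx f d) = diag_mx (map_mx f d) *m M.
Proof.
move=> Md; apply/matrixP => j k; have /matrixP/(_ j k) := Md.
rewrite !mul_mx_diag !mul_diag_mx !mxE => e.
have [->|djk] := eqVneq (d 0 j) (d 0 k); first by rewrite mulrC.
suff -> : M j k = 0 by rewrite mulr0 mul0r.
move/eqP: e; rewrite mulrC -subr_eq0 -mulrBl mulf_eq0 subr_eq0 => /orP[/eqP e|/eqP //].
by rewrite e eqxx in djk.
Qed.

(* [V I^*] is the partial isometry of the polar decomposition of [S]; the last
   clause is its variational characterization. *)
Lemma polar_intertwiner m n (a : H -> 'M[C]_m) (b : H -> 'M[C]_n) (S : 'M[C]_(n, m)) :
  is_unitary_rep a -> is_unitary_rep b -> intertwines a b S ->
  exists k (c : H -> 'M[C]_k) (I : 'M[C]_(m, k)) (V : 'M[C]_(n, k)),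
  [/\ is_unitary_rep c, I^t* *m I = 1%:M /\ V^t* *m V = 1%:M,
      intertwines c a I, intertwines c b V
    & forall Z : 'M[C]_(n, m),
        (forall l (A : 'M[C]_(m, l)), fro (Z *m A) <= fro A) ->
        dotm Z S <= dotm (V *m I^t*) S].
Proof.
move=> aP bP SE; have [N NS] : exists N, S^t* *m S = N by exists (S^t* *m S).
have Nn : N \is normalmx by apply/normalmxP; rewrite -NS trmxC_mul trmxCK.
set P := spectralmx N; set d := spectral_diag N.
have [PP PtP] : P *m P^t* = 1%:M /\ P^t* *m P = 1%:M.
  by apply: unitary_adj; exact: spectral_unitarymx.
have NE : N = P^t* *m diag_mx d *m P.
  by have /orthomx_spectralP := Nn; rewrite invmx_unitary ?spectral_unitarymx.
(* The eigenvalues are diagonal entries of the Gram matrix of S P^*. *)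
have d0 j : 0 <= d 0 j.
  have : diag_mx d = (S *m P^t*)^t* *m (S *m P^t*).
    rewrite trmxC_mul trmxCK -mulmxA (mulmxA _ S) NS NE !mulmxA PP mul1mx.
    by rewrite -mulmxA PP mulmx1.
  move/matrixP/(_ j j); rewrite !mxE eqxx mulr1n => ->.
  by apply: sumr_ge0 => k _; rewrite !mxE mulrC mul_conjC_ge0.
(* Functional calculus: [F f] is f(N). *)
pose F (f : C -> C) := P^t* *m diag_mx (map_mx f d) *m P.
have F_ext f g : (forall j, f (d 0 j) = g (d 0 j)) -> F f = F g.
  by move=> fg; congr (_ *m diag_mx _ *m _); apply/rowP => j; rewrite !mxE.
have FM f g : F f *m F g = F (fun x => f x * g x).
  rewrite /F -!mulmxA (mulmxA P) PP mul1mx (mulmxA (diag_mx _)) mulmx_diag !mulmxA.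
  by congr (_ *m diag_mx _ *m _); apply/rowP => j; rewrite !mxE.
have Ft f : (forall j, Num.conj_op (f (d 0 j)) = f (d 0 j)) -> (F f)^t* = F f.
  move=> fr; rewrite /F !trmxC_mul trmxCK tr_diag_mx map_diag_mx mulmxA.
  by congr (_ *m diag_mx _ *m _); apply/rowP => j; rewrite !mxE; exact: fr.
have FN : N = F id.
  rewrite /F; have -> : map_mx id d = d by apply/rowP => j; rewrite mxE.
  exact: NE.
have F1 : F (fun=> 1) = 1%:M.
  rewrite /F; have -> : map_mx (fun=> 1) d = const_mx 1 :> 'rV[C]_m
    by apply/rowP => j; rewrite !mxE.
  by rewrite diag_const_mx mulmx1 PtP.
have NaE : intertwines a a N.
  by rewrite -NS; exact: intertwines_comp SE (intertwines_adj aP bP SE).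
have FaE f : intertwines a a (F f).
  move=> h; have [M ME] : exists M, M = P *m a h *m P^t* by exists (P *m a h *m P^t*).
  have aM : a h = P^t* *m M *m P by rewrite ME !mulmxA PtP mul1mx -mulmxA PtP mulmx1.
  have Md : M *m diag_mx d = diag_mx d *m M.
    have -> : diag_mx d = P *m N *m P^t*.
      by rewrite NE !mulmxA PP mul1mx -mulmxA PP mulmx1.
    rewrite ME !mulmxA -(mulmxA _ _ P) PtP mulmx1 -(mulmxA _ _ P) PtP mulmx1.
    by rewrite -(mulmxA P (a h)) NaE !mulmxA.
  rewrite aM /F !mulmxA -(mulmxA _ P) PP mulmx1 -(mulmxA _ P) PP mulmx1.
  by rewrite -(mulmxA _ M) commuting_diag // !mulmxA.
have FB f h : F f - F h = F (fun x => f x - h x).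
  rewrite /F -mulmxBl -mulmxBr; congr (_ *m _ *m _); apply/matrixP => j k.
  by rewrite !mxE mulrnBl.
have F0 : F (fun=> 0) = 0.
  rewrite /F; have -> : map_mx (fun=> 0) d = 0 :> 'rV[C]_m
    by apply/rowP => j; rewrite !mxE.
  by rewrite raddf0 mulmx0 mul0mx.
clearbody F.
(* [g] is the inverse square root, equal to 0 at 0 since the inverse of 0 is 0, so that [S *m F g]
   is the partial isometry of [S]. [F chi] projects onto the complement of the kernel, and the
   fourth root [q] gives the square root [F q] of |S|. *)
pose g (x : C) : C := (sqrtC x)^-1; pose chi (x : C) : C := (x != 0)%:R.
pose q (x : C) : C := sqrtC (sqrtC x).
have real0 (x : C) : 0 <= x -> Num.conj_op x = x by move=> x0; apply/CrealP/ger0_real.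
have s0 j : 0 <= sqrtC (d 0 j) by rewrite sqrtC_ge0.
have Fgt : (F g)^t* = F g by apply: Ft => j; apply: real0; rewrite invr_ge0.
have Fqt : (F q)^t* = F q by apply: Ft => j; apply: real0; rewrite sqrtC_ge0.
have Fct : (F chi)^t* = F chi by apply: Ft => j; apply: real0; rewrite ler0n.
pose U := S *m F g.
have UE : intertwines a b U by exact: intertwines_comp (FaE g) SE.
have gdg j : g (d 0 j) * (d 0 j) = sqrtC (d 0 j).
  rewrite /g -{2}(sqrtCK (d 0 j)) expr2; have [->|x0] := eqVneq (sqrtC (d 0 j)) 0.
    by rewrite invr0 !mul0r.
  by rewrite mulKf.
have sg j : sqrtC (d 0 j) * g (d 0 j) = chi (d 0 j).
  rewrite /g /chi; have [->|x0] := eqVneq (d 0 j) 0; first by rewrite sqrtC0 mul0r.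
  by rewrite divff // sqrtC_eq0.
have UU : U^t* *m U = F chi.
  rewrite /U trmxC_mul Fgt -!mulmxA (mulmxA _ S) NS FN !FM; apply: F_ext => j.
  by rewrite mulrA gdg sg.
have Uchi : U *m F chi = U.
  rewrite /U -mulmxA FM; congr (_ *m _); apply: F_ext => j.
  rewrite /g /chi; have [->|x0] := eqVneq (d 0 j) 0; last by rewrite mulr1.
  by rewrite sqrtC0 invr0 mul0r.
have UtS : U^t* *m S = F sqrtC.
  rewrite /U trmxC_mul Fgt -mulmxA NS FN FM; apply: F_ext => j; exact: gdg.
have SU : S = U *m F q *m F q.
  rewrite -mulmxA /U -mulmxA !FM.
  have -> : F (fun x => g x * (q x * q x)) = F chi.
    by apply: F_ext => j; rewrite -expr2 sqrtCK mulrC sg.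
  (* [S] vanishes on the kernel of [N]. *)
  apply/eqP; rewrite -subr_eq0; apply/eqP/fro_eq0.
  have -> : S - S *m F chi = S *m F (fun x => 1 - chi x).
    by rewrite -{1}(mulmx1 S) -mulmxBr -F1 FB.
  rewrite /fro /dotm trmxC_mul Ft; last first.
    by move=> j; apply: real0; rewrite /chi; case: (_ != _); rewrite ?subrr ?subr0.
  rewrite -mulmxA (mulmxA _ S) NS FN !FM.
  rewrite (F_ext _ (fun=> 0)) => [|j].
    by rewrite F0 mxtrace0.
  rewrite /chi; have [->|x0] := eqVneq (d 0 j) 0; first by rewrite mul0r mulr0.
  by rewrite subrr mul0r.
have froq : fro (F q) = complex.Re (\tr (F sqrtC)).
  rewrite /fro /dotm Fqt FM; congr (complex.Re (\tr _)); apply: F_ext => j.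
  by rewrite -expr2 sqrtCK.
have froUq : fro (U *m F q) = complex.Re (\tr (F sqrtC)).
  rewrite /fro /dotm trmxC_mul Fqt -mulmxA (mulmxA _ U) UU !FM.
  congr (complex.Re (\tr _)); apply: F_ext => j.
  rewrite /chi /q; have [->|x0] := eqVneq (d 0 j) 0; first
    by rewrite !(sqrtC0, mul0r, mulr0).
  by rewrite mul1r -expr2 sqrtCK.
have cc : F chi *m F chi = F chi.
  rewrite FM; apply: F_ext => j; rewrite /chi; by case: (_ != _); rewrite ?mulr1 ?mulr0.
have [k [I [I1 II]]] := projection_isometry Fct cc.
have IE : intertwines a a (I *m I^t*) by rewrite II; exact: FaE.
have [cP cE] := subrep aP I1 IE.
exists k, (fun h => I^t* *m a h *m I), I, (U *m I); split=> //.
- split=> //; rewrite trmxC_mul mulmxA -(mulmxA _ _ U) UU -II !mulmxA I1 mul1mx.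
  by rewrite I1.
- exact: intertwines_comp cE UE.
(* Since |S| = F q F q, the pairing of [Z] with [S] is that of Z F q with U F q. Both have squared
   norm at most tr |S|, which is the pairing of [U] with [S]. *)
move=> Z Zc; rewrite -mulmxA II Uchi {2}/dotm UtS.
have -> : dotm Z S = dotm (Z *m F q) (U *m F q).
  by rewrite {1}SU dotmC dotm_adjr Fqt dotmC.
have := dotm_le (Z *m F q) (U *m F q); have := Zc _ (F q); rewrite froq froUq; lra.
Qed.

End Polar.

(** * Gluing *)

Section Gluing.
Context (R : realType).
Local Notation C := R[i].

Lemma complementary_orthogonal n k l (I : 'M[C]_(n, k)) (J : 'M[C]_(n, l)) :
  I^t* *m I = 1%:M -> J^t* *m J = 1%:M -> I *m I^t* + J *m J^t* = 1%:M ->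
  I^t* *m J = 0 /\ J^t* *m I = 0.
Proof.
move=> I1 J1 IJ; have IJ0 : I^t* *m J = 0.
  have := congr1 (fun X => I^t* *m X *m J) IJ.
  rewrite mulmxDr mulmxDl mulmx1 !mulmxA I1 mul1mx -(mulmxA _ (J^t*)) J1 mulmx1.
  by rewrite -[RHS]addr0 => /addrI.
by split=> //; rewrite -[RHS]trmxC0 -IJ0 trmxC_mul trmxCK.
Qed.

(** Reassociation of K0 + K1 + B: [L] embeds K1 + B as the complement of [K0] in Y + B. *)
Lemma glue_isometries n m k0 k1 b (P : 'M[C]_(n, m)) (Q : 'M[C]_(n, b))
    (I : 'M[C]_(m, k0)) (J : 'M[C]_(m, k1)) (p : 'M[C]_(k1 + b, k1))
    (q : 'M[C]_(k1 + b, b)) (L := P *m J *m p^t* + Q *m q^t*) :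
  P^t* *m P = 1%:M -> Q^t* *m Q = 1%:M -> P *m P^t* + Q *m Q^t* = 1%:M ->
  I^t* *m I = 1%:M -> J^t* *m J = 1%:M -> I *m I^t* + J *m J^t* = 1%:M ->
  p^t* *m p = 1%:M -> q^t* *m q = 1%:M -> p *m p^t* + q *m q^t* = 1%:M ->
  [/\ L^t* *m L = 1%:M, L^t* *m P = p *m J^t*
    & (P *m I) *m (P *m I)^t* + L *m L^t* = 1%:M].
Proof.
move=> P1 Q1 PQ I1 J1 IJ p1 q1 pq.
have [PQ0 QP0] := complementary_orthogonal P1 Q1 PQ.
have [pq0 qp0] := complementary_orthogonal p1 q1 pq.
have LP : L^t* *m P = p *m J^t*.
  rewrite /L trmxC_add !trmxC_mul !trmxCK mulmxDl -!mulmxA P1 mulmx1.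
  by rewrite QP0 mulmx0 addr0.
have LQ : L^t* *m Q = q.
  rewrite /L trmxC_add !trmxC_mul !trmxCK mulmxDl -!mulmxA PQ0 !mulmx0 add0r.
  by rewrite Q1 mulmx1.
split=> //.
  rewrite {2}/L mulmxDr !mulmxA LP LQ -(mulmxA p) J1 mulmx1; exact: pq.
have Lp : L *m p = P *m J.
  by rewrite /L mulmxDl -!mulmxA p1 qp0 !mulmx0 addr0 mulmx1.
have Lq : L *m q = Q.
  by rewrite /L mulmxDl -!mulmxA q1 pq0 !mulmx0 add0r mulmx1.
rewrite {2}/L trmxC_add !trmxC_mul !trmxCK mulmxDr !mulmxA Lp Lq.
by rewrite -PQ addrA -!(mulmxA P) -mulmxDr -mulmxDl IJ mul1mx.
Qed.

(** [V] identifies the two copies of the common part and acts as [W] between their complements. *)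
Lemma glue_unitary n1 n2 k l1 l2 (M1 : 'M[C]_(n1, k)) (M2 : 'M[C]_(n2, k))
    (L1 : 'M[C]_(n1, l1)) (L2 : 'M[C]_(n2, l2)) (W : 'M[C]_(l2, l1))
    (V := M2 *m M1^t* + L2 *m W *m L1^t*) :
  M1^t* *m M1 = 1%:M -> L1^t* *m L1 = 1%:M -> M1 *m M1^t* + L1 *m L1^t* = 1%:M ->
  M2^t* *m M2 = 1%:M -> L2^t* *m L2 = 1%:M -> M2 *m M2^t* + L2 *m L2^t* = 1%:M ->
  W *m W^t* = 1%:M -> W^t* *m W = 1%:M ->
  V *m V^t* = 1%:M /\ V^t* *m V = 1%:M.
Proof.
move=> m1 l1' ml1 m2 l2' ml2 WW WtW.
have [M1L1 L1M1] := complementary_orthogonal m1 l1' ml1.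
have [M2L2 L2M2] := complementary_orthogonal m2 l2' ml2.
have VM : V *m M1 = M2.
  by rewrite /V mulmxDl -!mulmxA m1 L1M1 !mulmx0 addr0 mulmx1.
have VL : V *m L1 = L2 *m W.
  by rewrite /V mulmxDl -!mulmxA l1' M1L1 !mulmx0 add0r mulmx1.
have VtM : V^t* *m M2 = M1.
  rewrite /V trmxC_add !trmxC_mul !trmxCK mulmxDl -!mulmxA m2 L2M2 !mulmx0 addr0.
  by rewrite mulmx1.
have VtL : V^t* *m L2 = L1 *m W^t*.
  rewrite /V trmxC_add !trmxC_mul !trmxCK mulmxDl -!mulmxA l2' M2L2 !mulmx0 add0r.
  by rewrite mulmx1.
split.
  rewrite {2}/V trmxC_add !trmxC_mul !trmxCK mulmxDr !mulmxA VM VL.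
  by rewrite -(mulmxA L2) WW mulmx1.
rewrite {2}/V mulmxDr !mulmxA VtM VtL.
by rewrite -(mulmxA L1) WtW mulmx1.
Qed.

Lemma direct_sum_rep (K : groupType) m n (a : K -> 'M[C]_m) (b : K -> 'M[C]_n) :
  is_unitary_rep a -> is_unitary_rep b ->
  exists (c : K -> 'M[C]_(m + n)) (P : 'M[C]_(m + n, m)) (Q : 'M[C]_(m + n, n)),
  [/\ is_unitary_rep c, intertwines a c P, intertwines b c Q
    & [/\ P^t* *m P = 1%:M, Q^t* *m Q = 1%:M & P *m P^t* + Q *m Q^t* = 1%:M]].
Proof.
move=> aP bP; pose P := col_mx 1%:M 0 : 'M[C]_(m + n, m).
pose Q := col_mx 0 1%:M : 'M[C]_(m + n, n).
have adj k (A : 'M[C]_(m, k)) (B : 'M[C]_(n, k)) : (col_mx A B)^t* = row_mx (A^t*) (B^t*).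
  by rewrite tr_col_mx map_row_mx.
have P1 : P^t* *m P = 1%:M.
  by rewrite /P adj mul_row_col trmxC1 trmxC0 mul0mx addr0 mulmx1.
have Q1 : Q^t* *m Q = 1%:M.
  by rewrite /Q adj mul_row_col trmxC1 trmxC0 mul0mx add0r mulmx1.
have PQ : P *m P^t* + Q *m Q^t* = 1%:M.
  rewrite /P /Q !adj !trmxC1 !trmxC0 !mul_col_row add_block_mx.
  by rewrite !(mulmx1, mulmx0, addr0, add0r) -scalar_mx_block.
have [PQ0 QP0] := complementary_orthogonal P1 Q1 PQ.
pose c h := P *m a h *m P^t* + Q *m b h *m Q^t*.
have cPE : intertwines a c P.
  by move=> h; rewrite /c mulmxDl -!mulmxA P1 QP0 !mulmx0 addr0 mulmx1.
have cQE : intertwines b c Q.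
  by move=> h; rewrite /c mulmxDl -!mulmxA Q1 PQ0 !mulmx0 add0r mulmx1.
exists c, P, Q; split=> //; split=> [h|g h].
  have [ah _] := rep_unitary h aP; have [bh _] := rep_unitary h bP.
  apply/unitarymxP; rewrite {2}/c trmxC_add !trmxC_mul !trmxCK mulmxDr !mulmxA.
  by rewrite cPE cQE -!mulmxA (mulmxA (a h)) ah mul1mx (mulmxA (b h)) bh mul1mx.
have [_ aM] := aP; have [_ bM] := bP.
rewrite {3}/c mulmxDr !mulmxA cPE cQE -!mulmxA.
by rewrite (mulmxA (a g)) -aM (mulmxA (b g)) -bM !mulmxA.
Qed.

Lemma intertwinesD (K : groupType) m n (a : K -> 'M[C]_m) (b : K -> 'M[C]_n)
    (A B : 'M[C]_(n, m)) :
  intertwines a b A -> intertwines a b B -> intertwines a b (A + B).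
Proof. by move=> AE BE h; rewrite mulmxDr mulmxDl AE BE. Qed.

Lemma restrict_rep (G H : groupType) (i : {multiplicative H -> G}) n (a : G -> 'M[C]_n) :
  is_unitary_rep a -> is_unitary_rep (fun h => a (i h)).
Proof. by move=> [aU aM]; split=> [h|g h]; rewrite ?gmulfM ?aM. Qed.

End Gluing.

(** * Amalgamating unitary representations *)

Section Arithmetic.
Context (R : realType).
Implicit Types e l d k t x f b KN N delta : R.

(** Here [d] is the dimension of the given space, [e1] the excess over it, [k] the dimension of the
    common part, [l1] that of its complement, and [uX], [xS], [uS] are inner products. As k is at
    most d + e1, f / 4 is at most (d - uX) / 2 + e1 / 4, and half of the left side is absorbed. *)
Lemma overlap_defect e1 d k l1 uX xS uS f x KN :
  l1 = e1 + d - k -> 0 <= l1 -> xS <= uS ->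
  d - uX - (xS - uS) <= f / 4 + x -> f = d + k - 2 * uX -> x <= 2 * KN ->
  d - uX <= e1 / 2 + 4 * KN.
Proof. lra. Qed.

Lemma overlap_rank d k uX : 2 * uX <= k + d -> d - 2 * (d - uX) <= k.
Proof. lra. Qed.

Lemma overlap_distance x d uX : x <= d -> x + d - 2 * uX <= 2 * (d - uX).
Proof. lra. Qed.

Lemma complement_size e1 e2 l1 l2 d k t KN N delta :
  l1 = e1 + d - k -> l2 = e2 + d - k -> d - 2 * t <= k -> t <= e1 / 2 + 4 * KN ->
  0 <= e1 -> 0 <= e2 -> 0 <= delta -> e1 + e2 + delta <= N ->
  l1 + l2 <= 3 * N + 16 * KN.
Proof. lra. Qed.

Lemma glued_size e1 e2 d b N delta DMN MN :
  b <= DMN -> 0 <= e2 -> 0 <= delta -> e1 + e2 + delta <= N -> 0 <= MN ->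
  d + e1 + b <= d + (N + DMN + 24 * MN).
Proof. lra. Qed.

Lemma glued_defect e1 e2 l1 d k t x f KN N delta DMN :
  f <= 4 * x -> x <= 2 * (2 * t + l1) -> t <= e1 / 2 + 4 * KN ->
  d - 2 * t <= k -> l1 = e1 + d - k -> 0 <= e1 -> 0 <= e2 -> 0 <= delta ->
  e1 + e2 + delta <= N -> 0 <= N -> 0 <= KN -> 0 <= DMN ->
  2 * f <= N + DMN + (72 * N + 384 * KN).
Proof. lra. Qed.

End Arithmetic.

Section AmalgamateReps.
Context (R : realType) (G H : groupType) (i : {multiplicative H -> G}).
Local Notation C := R[i].
Context (r : nat) (T : 'I_r -> irr_unitary_rep R H).
Hypothesis TP : forall t : irr_unitary_rep R H, exists j, rep_iso t (T j).

Let obj := {n : nat & {a : G -> 'M[C]_n | is_unitary_rep a}}.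
Let mk n (a : G -> 'M[C]_n) (aP : is_unitary_rep a) : obj := existT _ n (exist _ a aP).
Let dim (A : obj) := projT1 A.
Let mult (A : obj) m := has_reps T (fun h => sval (projT2 A) (i h)) m.

Let correction : exists C, forall A1 A2 m0 m1 m2,
    mult A1 (fun j => m0 j + m1 j)%N -> mult A2 (fun j => m0 j + m2 j)%N ->
  exists B1 B2 b1 b2,
    [/\ mult B1 b1, mult B2 b2, forall j, (m1 j + b1 j = m2 j + b2 j)%N,
        (dim B1 <= C * (\sum_j m1 j + \sum_j m2 j))%N
      & (dim B2 <= C * (\sum_j m1 j + \sum_j m2 j))%N].
Proof.
apply: bounded_correction => [|[m [a aP]] [n [b bP]]].
  have vP : is_unitary_rep (fun _ : G => 1%:M : 'M[C]_0).
    split=> [g|g h]; last by rewrite mulmx1.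
    by apply/unitarymxP; rewrite trmxC1 mulmx1.
  exists (mk vP); split=> //; exact: has_reps0.
have [c [P [Q [cP PE QE [P1 Q1 PQ]]]]] := direct_sum_rep aP bP.
exists (mk cP); split=> // m1 m2; rewrite /mult /=.
by apply: has_repsD P1 Q1 PQ _ _ => h; [exact: PE|exact: QE].
Qed.

(** The identification [J2 *m J1^t*] passes through C^d, where both matrices are close to [u]. The
    estimate for [J1] is used in adjoint form, which unitarity of [u] and [A1] permits. *)
Lemma fro_commutator_le n1 n2 d (J1 : 'M[C]_(n1, d)) (J2 : 'M[C]_(n2, d)) (u : 'M[C]_d)
    (A1 : 'M[C]_n1) (A2 : 'M[C]_n2) :
  J1^t* *m J1 = 1%:M -> J2^t* *m J2 = 1%:M ->
  u \is unitarymx -> A1 \is unitarymx ->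
  fro (A2 *m (J2 *m J1^t*) - J2 *m J1^t* *m A1) <=
  2 * (fro (J1 *m u - A1 *m J1) + fro (J2 *m u - A2 *m J2)).
Proof.
move=> J11 J21 /unitary_adj[uu utu] /unitary_adj[AA AtA].
pose X := u *m J1^t* - J1^t* *m A1.
have -> : A2 *m (J2 *m J1^t*) - J2 *m J1^t* *m A1 =
    - ((J2 *m u - A2 *m J2) *m J1^t*) + J2 *m X.
  rewrite /X mulmxBl mulmxBr !mulmxA opprB.
  by rewrite addrA subrK.
apply: le_trans (froD_le _ _) _; rewrite ler_pM2l ?ltr0n // addrC froN.
apply: lerD; last by rewrite fro_isor // trmxCK.
rewrite fro_isol // -fro_trmxC /X trmxC_sub !trmxC_mul trmxCK.
have -> : J1 *m u^t* - A1^t* *m J1 = - (A1^t* *m ((J1 *m u - A1 *m J1) *m u^t*)).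
  rewrite mulmxBl mulmxBr -!mulmxA uu mulmx1 (mulmxA (A1^t*)) AtA mul1mx.
  by rewrite opprB.
by rewrite froN fro_isol ?fro_isor ?trmxCK.
Qed.

(** Counterpart of [amalgamate_actions], with the same asymmetry. [X] identifies the two copies of
    C^d, [S] is a true intertwiner near it, and [U] is the polar part of [S]; the number [t]
    controls both the dimension left over and the mismatch of the embeddings. *)
Lemma amalgamate_reps : finitely_generated H ->
  exists (K : R) (s : seq H), 0 <= K /\
  forall d n1 n2 (J1 : 'M[C]_(n1, d)) (J2 : 'M[C]_(n2, d)) (phi : H -> 'M[C]_d)
    (a1 : G -> 'M[C]_n1) (a2 : G -> 'M[C]_n2) (N : R),
  J1^t* *m J1 = 1%:M -> J2^t* *m J2 = 1%:M -> (forall h, phi h \is unitarymx) ->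
  is_unitary_rep a1 -> is_unitary_rep a2 ->
  (n1%:R - d%:R) + (n2%:R - d%:R) + \sum_(h <- s)
    (fro (J1 *m phi h - a1 (i h) *m J1) + fro (J2 *m phi h - a2 (i h) *m J2)) <= N ->
  exists n (J : 'M[C]_(n, d)) (b1 b2 : G -> 'M[C]_n),
  [/\ [/\ J^t* *m J = 1%:M, is_unitary_rep b1, is_unitary_rep b2 &
        forall h, b1 (i h) = b2 (i h)],
      n%:R <= d%:R + K * N,
      forall u g, fro (J *m u - b1 g *m J) <= fro (J1 *m u - a1 g *m J1)
    & forall u g, u \is unitarymx ->
        fro (J *m u - b2 g *m J) <= 2 * fro (J2 *m u - a2 g *m J2) + K * N].
Proof.
move=> /(uniform_gap TP)[s [K [K0 gap]]]; have [D DP] := correction.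
pose M : R := 3 + 16 * K.
have M0 : 0 <= M by rewrite /M; lra.
(* M N bounds the dimensions of the two complements together, hence D M N bounds that of the added
   summand. The 1 pays for the excess of the first space, and 24 M for the failure of [V] to match
   the embeddings. *)
exists (1 + (D%:R + 24) * M), s; split.
  by rewrite addr_ge0 // mulr_ge0 // addr_ge0.
move=> d n1 n2 J1 J2 phi a1 a2 N J11 J21 phiU a1P a2P NE.
have dim_le n (J : 'M[C]_(n, d)) : J^t* *m J = 1%:M -> 0 <= n%:R - d%:R :> R.
  move=> JJ; have [l [L [L1 JL]]] := complement_isometry JJ.
  by rewrite (isometry_dim JJ L1 JL) natrD addrC addKr.
have a1H := restrict_rep i a1P; have a2H := restrict_rep i a2P.
pose X := J2 *m J1^t*.
have [S SE XS] := gap _ _ _ _ X a1H a2H.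
have d1 := dim_le _ _ J11; have d2 := dim_le _ _ J21.
set e1 := (n1%:R - d%:R) in NE d1; set e2 := (n2%:R - d%:R) in NE d2.
set delta := \sum_(h <- s) _ in NE.
have delta0 : 0 <= delta.
  by apply: sumr_ge0 => h _; apply: addr_ge0; exact: fro_ge0.
have {}XS : fro (X - S) <= 2 * (K * N).
  apply: le_trans XS _; rewrite mulrCA; apply: ler_wpM2l => //.
  apply: (@le_trans _ _ (2 * delta)); last first.
    by rewrite ler_pM2l ?ltr0n //; apply: le_trans NE; rewrite lerDr addr_ge0.
  rewrite /delta mulr_sumr; apply: ler_sum => h _.
  apply: fro_commutator_le => //; first by have [] := a1H.
have [k [c [I1 [I2 [cP [I11 I21] I1E I2E IS]]]]] := polar_intertwiner a1H a2H SE.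
pose U := I2 *m I1^t*.
have froX : fro X = d%:R by rewrite /X fro_isol // fro_trmxC fro_iso.
have froU : fro U = k%:R by rewrite /U fro_isol // fro_trmxC fro_iso.
(* The identification is a contraction, so it competes in the variational inequality. *)
have US : dotm X S <= dotm U S.
  by apply: IS => l A; rewrite /X -mulmxA fro_isol //; exact: fro_coisol.
have [l1 [c1 [L1 [c1P L11 L1E IL1]]]] := complement_rep a1H cP I11 I1E.
have [l2 [c2 [L2 [c2P L21 L2E IL2]]]] := complement_rep a2H cP I21 I2E.
have n1E := isometry_dim I11 L11 IL1; have n2E := isometry_dim I21 L21 IL2.
(* The squared distance from [U] to [X] is 2 t + k - d. *)
pose t := d%:R - dotm U X.
have l1E : l1%:R = e1 + d%:R - k%:R :> R.
  by rewrite /e1 subrK [in RHS]n1E natrD addrC addKr.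
have l2E : l2%:R = e2 + d%:R - k%:R :> R.
  by rewrite /e2 subrK [in RHS]n2E natrD addrC addKr.
have l10 : 0 <= l1%:R :> R by [].
(* By [US] the inner product of X - U and X - S is at least [t]. It is at most a quarter of the
   squared norm of X - U, which is absorbed, plus that of X - S, which the gap controls. *)
have t_le : t <= e1 / 2 + 4 * (K * N).
  apply: overlap_defect l1E l10 US _ (erefl _) XS.
  have := dotm_le4 (X - U) (X - S); rewrite froBE froX froU (dotmC X U).
  suff -> : dotm (X - U) (X - S) = d%:R - dotm U X - (dotm X S - dotm U S) by [].
  rewrite !dotmE -/(fro X) froX.
  by move: (dotm X S) (dotm U X) (dotm U S) d%:R => x y z w; ring.
have tk : d%:R - 2 * t <= k%:R.
  have := dotm_le U X; rewrite froU froX; exact: overlap_rank.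
have NN : 0 <= N by apply: le_trans NE; apply: addr_ge0 => //; exact: addr_ge0.
have KN : 0 <= K * N by exact: mulr_ge0.
have lM : l1%:R + l2%:R <= M * N.
  have -> : M * N = 3 * N + 16 * (K * N) by rewrite /M mulrDl -mulrA.
  exact: complement_size l1E l2E tk t_le d1 d2 delta0 NE.
have [m0 cm0] := has_reps_exists TP cP.
have [m1 cm1] := has_reps_exists TP c1P.
have [m2 cm2] := has_reps_exists TP c2P.
have A1m : mult (mk a1P) (fun j => m0 j + m1 j)%N.
  exact: has_repsD I11 L11 IL1 I1E L1E cm0 cm1.
have A2m : mult (mk a2P) (fun j => m0 j + m2 j)%N.
  exact: has_repsD I21 L21 IL2 I2E L2E cm0 cm2.
have [[b1 [B1 B1P]] [[b2 [B2 B2P]] [m1' [m2' [B1m B2m mm B1D _]]]]] := DP _ _ _ _ _ A1m A2m.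
have b1M : b1%:R <= D%:R * (M * N).
  apply: (@le_trans _ _ (D * (l1 + l2))%:R).
    rewrite ler_nat; apply: leq_trans B1D _; rewrite leq_mul2l; apply/orP; right.
    by apply: leq_add; [exact: has_reps_dim cm1|exact: has_reps_dim cm2].
  by rewrite natrM natrD ler_wpM2l.
have [al [P1 [Q1 [alP P1E Q1E [P11 Q11 PQ1]]]]] := direct_sum_rep a1P B1P.
have [be [P2 [Q2 [beP P2E Q2E [P21 Q21 PQ2]]]]] := direct_sum_rep a2P B2P.
have [g1 [p1 [q1 [g1P p1E q1E [p11 q11 pq1]]]]] := direct_sum_rep c1P (restrict_rep i B1P).
have [g2 [p2 [q2 [g2P p2E q2E [p21 q21 pq2]]]]] := direct_sum_rep c2P (restrict_rep i B2P).
have [W [WW WtW WE]] : exists W : 'M[C]_(l2 + b2, l1 + b1),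
    [/\ W *m W^t* = 1%:M, W^t* *m W = 1%:M & intertwines g1 g2 W].
  apply: (@has_reps_iso _ _ _ T _ _ _ _ (fun j => m1 j + m1' j)%N) => //.
    exact: has_repsD p11 q11 pq1 p1E q1E cm1 B1m.
  have -> : (fun j => m1 j + m1' j)%N = (fun j => m2 j + m2' j)%N by apply/funext.
  exact: has_repsD p21 q21 pq2 p2E q2E cm2 B2m.
have [] := glue_isometries P11 Q11 PQ1 I11 L11 IL1 p11 q11 pq1.
set F1 := P1 *m L1 *m p1^t* + Q1 *m q1^t* => F11 FP1 PF1.
have [] := glue_isometries P21 Q21 PQ2 I21 L21 IL2 p21 q21 pq2.
set F2 := P2 *m L2 *m p2^t* + Q2 *m q2^t* => F21 FP2 PF2.
have PI1 := isometry_mul P11 I11; have PI2 := isometry_mul P21 I21.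
have [] := glue_unitary PI1 F11 PF1 PI2 F21 PF2 WW WtW.
set V := P2 *m I2 *m (P1 *m I1)^t* + F2 *m W *m F1^t* => VV VtV.
have alH := restrict_rep i alP; have beH := restrict_rep i beP.
have VE : intertwines (fun h => al (i h)) (fun h => be (i h)) V.
  have P1H : intertwines (fun h => a1 (i h)) (fun h => al (i h)) P1 by move=> h; exact: P1E.
  have Q1H : intertwines (fun h => B1 (i h)) (fun h => al (i h)) Q1 by move=> h; exact: Q1E.
  have P2H : intertwines (fun h => a2 (i h)) (fun h => be (i h)) P2 by move=> h; exact: P2E.
  have Q2H : intertwines (fun h => B2 (i h)) (fun h => be (i h)) Q2 by move=> h; exact: Q2E.
  have B1H := restrict_rep i B1P; have B2H := restrict_rep i B2P.
  have F1E : intertwines g1 (fun h => al (i h)) F1.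
    apply: intertwinesD; last exact: intertwines_comp (intertwines_adj B1H g1P q1E) Q1H.
    apply: intertwines_comp (intertwines_adj c1P g1P p1E) _.
    exact: intertwines_comp L1E P1H.
  have F2E : intertwines g2 (fun h => be (i h)) F2.
    apply: intertwinesD; last exact: intertwines_comp (intertwines_adj B2H g2P q2E) Q2H.
    apply: intertwines_comp (intertwines_adj c2P g2P p2E) _.
    exact: intertwines_comp L2E P2H.
  apply: intertwinesD.
    apply: intertwines_comp (intertwines_adj cP alH (intertwines_comp I1E P1H)) _.
    exact: intertwines_comp I2E P2H.
  apply: intertwines_comp (intertwines_adj g1P alH F1E) _.
  exact: intertwines_comp WE F2E.
pose b2' g := V^t* *m be g *m V.
have b2'E : intertwines b2' be V.
  by move=> g; rewrite /b2' !mulmxA VV mul1mx.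
have b2'P : is_unitary_rep b2'.
  split=> [g|g h].
    apply/unitarymxP; have [bb _] := rep_unitary g beP.
    rewrite {2}/b2' !trmxC_mul trmxCK !mulmxA -(mulmxA _ V) VV mulmx1.
    by rewrite -(mulmxA _ (be g)) bb mulmx1.
  have [_ beM] := beP.
  by rewrite /b2' beM -!mulmxA (mulmxA V (V^t*)) VV mul1mx.
(* How far [V] is from carrying one embedding of C^d to the other. *)
pose E := V *m (P1 *m J1) - P2 *m J2.
have PJ1 := isometry_mul P11 J11; have PJ2 := isometry_mul P21 J21.
have froE : fro E <= 2 * (2 * t + l1%:R).
  (* The first term compares [U] with the identification; the second comes from the component of
     [J1] in the complement, of squared norm at most [l1]. *)
  have -> : E = P2 *m (U *m J1 - J2) + F2 *m (W *m (p1 *m (L1^t* *m J1))).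
    rewrite /E /V mulmxDl trmxC_mul -!mulmxA (mulmxA (P1^t*)) P11 mul1mx.
    rewrite (mulmxA (F1^t*)) FP1 /U mulmxBr -?mulmxA.
    by rewrite addrAC.
  apply: le_trans (froD_le _ _) _; rewrite ler_pM2l ?ltr0n //; apply: lerD.
    rewrite fro_isol // froBE (fro_iso J21).
    have -> : dotm (U *m J1) J2 = dotm U X by rewrite dotm_adjr.
    have : fro (U *m J1) <= d%:R.
      by rewrite /U -mulmxA fro_isol // -(fro_iso J11); exact: fro_coisol.
    exact: overlap_distance.
  rewrite (fro_isol _ F21) (fro_isol _ WtW) (fro_isol _ p11).
  rewrite -(fro_iso L11) -fro_trmxC trmxC_mul trmxCK.
  exact: fro_coisol.
exists (n1 + b1)%N, (P1 *m J1), al, b2'; split.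
- split=> // h; rewrite /b2' -mulmxA VE mulmxA VtV mul1mx //.
- have -> : (1 + (D%:R + 24) * M) * N = N + D%:R * (M * N) + 24 * (M * N) by ring.
  have MN : 0 <= M * N by exact: mulr_ge0.
  rewrite natrD; have -> : n1%:R = d%:R + e1 :> R by rewrite addrC subrK.
  exact: glued_size b1M d2 delta0 NE MN.
- move=> u g; rewrite mulmxA P1E -!mulmxA -mulmxBr fro_isol //.
move=> u g uU; have [uu utu] := unitary_adj uU.
rewrite -(fro_isol _ VtV).
have [_ beU] := rep_unitary g beP.
have -> : V *m (P1 *m J1 *m u - b2' g *m (P1 *m J1)) =
    P2 *m (J2 *m u - a2 g *m J2) + (E *m u - be g *m E).
  rewrite mulmxBr (mulmxA V (b2' g)) -b2'E /E mulmxBl !mulmxBr !mulmxA P2E.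
  by rewrite opprB [RHS]addrCA !subrKA.
apply: le_trans (froD_le _ _) _; rewrite mulrDr fro_isol // lerD2l.
have fE : fro (E *m u - be g *m E) <= 4 * fro E.
  apply: le_trans (froD_le _ _) _; rewrite froN fro_isor // fro_isol //.
  suff -> : 2 * (fro E + fro E) = 4 * fro E by [].
  by ring.
have -> : (1 + (D%:R + 24) * M) * N = N + D%:R * (M * N) + (72 * N + 384 * (K * N)).
  by rewrite /M; ring.
have DMN : 0 <= D%:R * (M * N) by rewrite !mulr_ge0.
exact: glued_defect fE froE t_le tk l1E d1 d2 delta0 NE NN KN DMN.
Qed.

End AmalgamateReps.

(** * Hilbert-Schmidt stability of the double *)

Section StableHS.
Context (R : realType) (G H : groupType) (i : {multiplicative H -> G}).
Local Notation C := R[i].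

Lemma double_rep n (b1 b2 : G -> 'M[C]_n) :
  is_unitary_rep b1 -> is_unitary_rep b2 -> (forall h, b1 (i h) = b2 (i h)) ->
  exists psi : group_double i -> 'M[C]_n, [/\ is_unitary_rep psi,
    forall g, psi (double_inl i g) = b1 g & forall g, psi (double_inr i g) = b2 g].
Proof.
move=> b1P b2P b12; have [b1U b1M] := b1P; have [b2U b2M] := b2P.
have [||||||||f [fM f1 f2]] := @double_lift _ _ i 'M[C]_n 1%:M mulmx b1 b2 => //.
- by move=> A B D; rewrite mulmxA.
- by move=> A; rewrite mul1mx.
- by move=> A; rewrite mulmx1.
- exact: rep1.
- exact: rep1.
exists f; split=> //; split=> //; apply: double_ind => [g|g|x y xU yU].
- by rewrite f1.
- by rewrite f2.
- rewrite fM; exact: mul_unitarymx xU yU.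
Qed.

(** Compressions are not multiplicative, so they are traded for the intertwining defect of [J]. The
    part of A J that leaves the range of [J] has squared norm at most the codimension, which is
    small because the ratio of the dimensions tends to 1. *)
Lemma compression_defect m n (J : 'M[C]_(n, m)) (u : 'M[C]_m) (A : 'M[C]_n) :
  J^t* *m J = 1%:M -> A \is unitarymx ->
  fro (J *m u - A *m J) <= 2 * (fro (u - J^t* *m A *m J) + (n%:R - m%:R)).
Proof.
move=> J1 /unitary_adj[AA AtA]; have [l [L [L1 JL]]] := complement_isometry J1.
have -> : n%:R - m%:R = fro L.
  by rewrite fro_iso // (isometry_dim J1 L1 JL) natrD addrC addKr.
have -> : J *m u - A *m J = J *m (u - J^t* *m A *m J) - L *m (L^t* *m (A *m J)).
  rewrite mulmxBr !mulmxA -addrA -opprD -!mulmxDl JL mul1mx //.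
apply: le_trans (froD_le _ _) _; rewrite ler_pM2l ?ltr0n //.
rewrite froN (fro_isol _ J1) (fro_isol _ L1) lerD2l.
rewrite -[X in X <= _]fro_trmxC !trmxC_mul trmxCK -mulmxA.
by apply: le_trans (fro_coisol _ J1) _; rewrite fro_isol // trmxCK.
Qed.

(** Three error terms with unitary factors moved out; the 4 comes from two uses of [froD_le]. *)
Lemma defect_mul m n (J : 'M[C]_(n, m)) (u v w : 'M[C]_m) (A B : 'M[C]_n) :
  J^t* *m J = 1%:M -> v \is unitarymx -> A \is unitarymx ->
  fro (J *m w - A *m B *m J) <=
  4 * (fro (u *m v - w) + (fro (J *m u - A *m J) + fro (J *m v - B *m J))).
Proof.
move=> J1 /unitary_adj[vv vtv] /unitary_adj[AA AtA].
have -> : J *m w - A *m B *m J = - (J *m (u *m v - w)) +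
    ((J *m u - A *m J) *m v + A *m (J *m v - B *m J)).
  rewrite !mulmxBr mulmxBl !mulmxA opprB.
  by move: (J *m w) (J *m u *m v) (A *m J *m v) (A *m B *m J) => x y z t; rewrite !subrKA.
apply: le_trans (froD_le _ _) _; rewrite froN fro_isol //.
have := froD_le ((J *m u - A *m J) *m v) (A *m (J *m v - B *m J)).
rewrite fro_isor // (fro_isol _ AtA); have := fro_ge0 (u *m v - w).
move: (fro (u *m v - w)) (fro (J *m u - A *m J)) (fro (J *m v - B *m J)) => x y z.
by move: (fro _) => t; lra.
Qed.

Lemma flexibly_HS_stable_double : finitely_generated H ->
  finite_rank {freeg (Irr_HS R H) / int} -> flexibly_HS_stable R G ->
  flexibly_HS_stable R (group_double i).
Proof.
move=> H_fg /finite_rank_freeg[irr irrP] G_stable d phi d0 phiU phiM.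
pose T (j : 'I_(size irr)) : irr_unitary_rep R H := repr (tnth (in_tuple irr) j).
have TP t : exists j, rep_iso t (T j).
  have /(nthP (\pi_(Irr_HS R H) t))[k ks kt] := irrP (\pi_(Irr_HS R H) t).
  exists (Ordinal ks); apply/asboolP; suff : rep_iso_rel t (T (Ordinal ks)) by [].
  rewrite -[rep_iso_rel _ _]eqmodE reprK (tnth_nth (\pi_(Irr_HS R H) t)) /=.
  by rewrite kt.
have [K [s [K0 sP]]] := amalgamate_reps i TP H_fg.
have dR n : (0 : R) < (d n)%:R by rewrite ltr0n d0.
have stab (e : G -> group_double i) : {morph e : x y / (x * y)%g} ->
    exists (m : nat -> nat) (J : forall n, 'M[C]_(m n, d n))
      (psi : forall n, G -> 'M[C]_(m n)),
    [/\ forall n, (J n)^t* *m J n = 1%:M,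
        ((m n)%:R / (d n)%:R : R) @[n --> \oo] --> (1 : R),
        forall n, is_unitary_rep (psi n)
      & forall g, fro (J n *m phi n (e g) - psi n g *m J n) / (d n)%:R
                    @[n --> \oo] --> (0 : R)].
  move=> eM; have [||m [J [psi [J1 md psiP psiJ]]]] :=
    G_stable d (fun n g => phi n (e g)) d0.
  - by move=> n g; exact: phiU.
  - by move=> g h; have := phiM (e g) (e h); rewrite -eM.
  exists m, J, psi; split=> // g.
  have md0 : (m n)%:R / (d n)%:R - 1 @[n --> \oo] --> (0 : R).
    by rewrite -(subrr (1 : R)); apply: cvgB => //; exact: cvg_cst.
  have /hs_norm_cvg psi0 := psiJ g.
  apply: le_cvg0 (cvg0M 2 (cvg0D psi0 md0)) => n.
  have -> : (m n)%:R / (d n)%:R - 1 = ((m n)%:R - (d n)%:R) / (d n)%:R :> R.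
    by rewrite mulrBl divff ?gt_eqF.
  rewrite divr_ge0 ?fro_ge0 ?ler0n //= -mulrDl mulrA ler_pM2r ?invr_gt0 //.
  by apply: compression_defect => //; have [] := psiP n.
have [m1 [J1 [a1 [J11 md1 a1P a1phi]]]] := stab _ (@double_inlM _ _ i).
have [m2 [J2 [a2 [J21 md2 a2P a2phi]]]] := stab _ (@double_inrM _ _ i).
pose N n : R := ((m1 n)%:R - (d n)%:R) + ((m2 n)%:R - (d n)%:R) + \sum_(h <- s)
  (fro (J1 n *m phi n (double_inl i (i h)) - a1 n (i h) *m J1 n) +
   fro (J2 n *m phi n (double_inl i (i h)) - a2 n (i h) *m J2 n)).
have N0 : N n / (d n)%:R @[n --> \oo] --> (0 : R).
  have sub0 (m : nat -> nat) : ((m n)%:R / (d n)%:R : R) @[n --> \oo] --> (1 : R) ->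
      ((m n)%:R - (d n)%:R) / (d n)%:R @[n --> \oo] --> (0 : R).
    move=> md; under eq_fun do rewrite mulrBl divff ?gt_eqF //.
    by rewrite -(subrr (1 : R)); apply: cvgB => //; exact: cvg_cst.
  under eq_fun do rewrite /N mulrDl [X in X + _]mulrDl mulr_suml.
  apply: cvg0D; first by apply: cvg0D; exact: sub0.
  apply: cvg0_sum => h; under eq_fun do rewrite mulrDl.
  by apply: cvg0D; [exact: a1phi|rewrite double_inl_inr; exact: a2phi].
have D n : exists D : {m : nat & ('M[C]_(m, d n) * (group_double i -> 'M[C]_m))%type},
  let J := (projT2 D).1 in let psi := (projT2 D).2 in
  [/\ J^t* *m J = 1%:M, is_unitary_rep psi, (projT1 D)%:R <= (d n)%:R + K * N n &
    forall g,
    fro (J *m phi n (double_inl i g) - psi (double_inl i g) *m J) <=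
      fro (J1 n *m phi n (double_inl i g) - a1 n g *m J1 n) /\
    fro (J *m phi n (double_inr i g) - psi (double_inr i g) *m J) <=
      2 * fro (J2 n *m phi n (double_inr i g) - a2 n g *m J2 n) + K * N n].
  have [m [J [b1 [b2 [[JJ b1P b2P b12] md B1 B2]]]]] :=
    sP _ _ _ _ _ (fun h => phi n (double_inl i (i h))) _ _ _
      (J11 n) (J21 n) (fun h => phiU n _) (a1P n) (a2P n) (lexx (N n)).
  have [psi [psiP psi1 psi2]] := double_rep b1P b2P b12.
  exists (existT _ m (J, psi)); split => //= g; rewrite psi1 psi2.
  by split; [exact: B1|exact: B2].
have [f DP] := exists_section D.
exists (fun n => projT1 (f n)), (fun n => (projT2 (f n)).1),
  (fun n => (projT2 (f n)).2).
have KN0 : K * (N n / (d n)%:R) @[n --> \oo] --> (0 : R) by exact: cvg0M.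
have defect x : fro ((projT2 (f n)).1 *m phi n x -
    (projT2 (f n)).2 x *m (projT2 (f n)).1) / (d n)%:R
    @[n --> \oo] --> (0 : R).
  elim/double_ind: x => [g|g|x y Px Py].
  - apply: le_cvg0 (a1phi g) => n; have [_ _ _ /(_ g)[le1 _]] := DP n.
    by rewrite divr_ge0 ?ler0n ?fro_ge0 //= ler_pM2r ?invr_gt0.
  - apply: le_cvg0 (cvg0D (cvg0M 2 (a2phi g)) KN0) => n.
    have [_ _ _ /(_ g)[_ le2]] := DP n.
    by rewrite divr_ge0 ?ler0n ?fro_ge0 //= !mulrA -mulrDl ler_pM2r ?invr_gt0.
  have /hs_norm_cvg xy0 := phiM x y.
  apply: le_cvg0 (cvg0M 4 (cvg0D xy0 (cvg0D Px Py))) => n.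
  have [JJ [psiU psiM] _ _] := DP n.
  rewrite divr_ge0 ?ler0n ?fro_ge0 //= -!mulrDl mulrA ler_pM2r ?invr_gt0 //.
  by rewrite psiM; apply: defect_mul.
split=> [n||n|g]; [by have [] := DP n| |by have [] := DP n|].
  apply: le_cvg1 KN0 => n; have [JJ _ md _] := DP n.
  have [l [L [L1 JL]]] := complement_isometry JJ.
  rewrite ler_pdivlMr // mul1r ler_nat [X in (_ <= X)%N](isometry_dim JJ L1 JL) leq_addr /=.
  by rewrite ler_pdivrMr // mulrDl mul1r -mulrA divfK ?gt_eqF.
(* Back to compressions: the adjoint of the isometry does not increase the norm. *)
apply/hs_norm_cvg; apply: le_cvg0 (defect g) => n.
rewrite divr_ge0 ?ler0n ?fro_ge0 //= ler_pM2r ?invr_gt0 //.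
have [JJ _ _ _] := DP n; move: JJ; move: (f n) => [m [J psi]] /= JJ.
have -> : phi n g - J^t* *m psi g *m J = J^t* *m (J *m phi n g - psi g *m J).
  by rewrite mulmxBr !mulmxA JJ mul1mx.
exact: fro_coisol.
Qed.

End StableHS.

Theorem theorem5 (R : realType) (c : metric_class) (G H : groupType)
    (i : {multiplicative H -> G}) (i_inj : injective i)
    (G_fg : finitely_generated G) (H_fg : finitely_generated H)
    (H_rk : finite_rank (Lambda R c H))
    (G_stable : flexibly_stable R c G) :
  flexibly_stable R c (group_double i).
Proof.
case: c H_rk G_stable => H_rk G_stable.
- exact: flexibly_HS_stable_double.
- exact: flexibly_P_stable_double.
Qed.
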